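(* Let $1<p<\infty$ and let $\omega:\mathbb{R}_+\to\mathbb{R}_+$ be continuous with $\omega\in B_p(\infty)$, i.e. $\int_1^\infty\omega(\tau)^{-1/(p-1)}\,d\tau<\infty$. Put $$\Omega^\infty_\omega(t):=\Big(\int_t^\infty\omega(\tau)^{-\frac{1}{p-1}}\,d\tau\Big)^{1-\frac1p},\qquad t>0,$$ and for $c\in\mathbb{R}$ define the following subsets of $D^{1,p}(\mathbb{R}_+,\omega)$: $$\mathcal{R}^\infty_{p,\omega}(c):=\Big\{u\in D^{1,p}(\mathbb{R}_+,\omega):\ u(t)=\int_t^\infty v(\tau)\,d\tau+c\ \text{ for all }t>0,\ \text{for some } v\in L^p(\mathbb{R}_+,\omega)\Big\},$$ $$\mathcal{A}^\infty_{p,\omega}(c):=\Big\{u\in D^{1,p}(\mathbb{R}_+,\omega):\ \text{there exists a sequence } t_n\nearrow\infty\text{ with }\lim_{n\to\infty}u(t_n)=c\Big\},$$ $$\mathcal{B}^\infty_{p,\omega}(c):=\Big\{u\in D^{1,p}(\mathbb{R}_+,\omega):\ \lim_{t\to\infty}u(t)=c\Big\},$$ $$\mathcal{C}^\infty_{p,\omega}(c):=\Big\{u\in D^{1,p}(\mathbb{R}_+,\omega):\ \lim_{t\to\infty}\frac{u(t)-c}{\Omega^\infty_\omega(t)}=0,\ \ \sup_{t>0}\frac{u(t)-c}{\Omega^\infty_\omega(t)}<\infty\Big\}.$$ Then: (i) For every $c\in\mathbb{R}$, $\mathcal{R}^\infty_{p,\omega}(c)$ is a closed subset of $D^{1,p}(\mathbb{R}_+,\omega)$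 equipped with any of the norms $\|\cdot\|^{(a)}_{D^{1,p}(\mathbb{R}_+,\omega)}$, $a\in\mathbb{R}_+$. (ii) For every $c\in\mathbb{R}$, $\mathcal{A}^\infty_{p,\omega}(c)=\mathcal{B}^\infty_{p,\omega}(c)=\mathcal{C}^\infty_{p,\omega}(c)=\mathcal{R}^\infty_{p,\omega}(c)$. (iii) For every $u\in D^{1,p}(\mathbb{R}_+,\omega)$ there is $c\in\mathbb{R}$ such that $u\in\mathcal{R}^\infty_{p,\omega}(c)$. In particular the operator $Tr^\infty(u):=\lim_{t\to\infty}u(t)$ is well defined for every $u\in D^{1,p}(\mathbb{R}_+,\omega)$, and $D^{1,p}(\mathbb{R}_+,\omega)=\bigcup_{c\in\mathbb{R}}\mathcal{R}^\infty_{p,\omega}(c)$. Moreover, $$D^{1,p}(\mathbb{R}_+,\omega)=\Big\{u(t)=\int_t^\infty v(\tau)\,d\tau+c:\ c\in\mathbb{R},\ v\in L^p(\mathbb{R}_+,\omega)\Big\}.$$ (iv) The quantity $\|u\|^{(\infty)}_{D^{1,p}(\mathbb{R}_+,\omega)}:=\|u'\|_{L^p(\mathbb{R}_+,\omega)}+|Tr^\infty(u)|$ is a norm on $D^{1,p}(\mathbb{R}_+,\omega)$, which is equivalent to any norm $\|\cdot\|^{(a)}_{D^{1,p}(\mathbb{R}_+,\omega)}$, $a\in\mathbb{R}_+$.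
   Context: $\mathbb{R}_+=(0,\infty)$. For a weight $\omega$, $L^p(\mathbb{R}_+,\omega)$ is the space of (classes of) measurable real functions $f$ with $\|f\|_{L^p(\mathbb{R}_+,\omega)}=\big(\int_0^\infty|f(t)|^p\omega(t)\,dt\big)^{1/p}<\infty$. The weighted Dirichlet space is $$D^{1,p}(\mathbb{R}_+,\omega)=\{u:\mathbb{R}_+\to\mathbb{R}:\ u\text{ is locally absolutely continuous on }\mathbb{R}_+\text{ and }\|u'\|_{L^p(\mathbb{R}_+,\omega)}<\infty\}.$$ For $a\in\mathbb{R}_+$ it carries the norm $\|u\|^{(a)}_{D^{1,p}(\mathbb{R}_+,\omega)}:=\|u'\|_{L^p(\mathbb{R}_+,\omega)}+|u(a)|$. *)

(* Defs.v *)
From HB Require Import structures.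
From mathcomp Require Import all_boot all_order all_algebra.
From mathcomp Require Import all_classical all_reals all_analysis.

Set Implicit Arguments.
Unset Strict Implicit.
Unset Printing Implicit Defensive.

Import Order.TTheory GRing.Theory Num.Theory.
Import numFieldNormedType.Exports.

Local Open Scope classical_set_scope.
Local Open Scope ring_scope.

Section normed_subspaces.
Context {R : realType} {V : lmodType R}.
Implicit Types (D S : set V) (N : V -> R).

Definition linear_subspace D : Prop :=
  D 0 /\ forall (k : R) (u v : V), D u -> D v -> D (k *: u + v).

Definition norm_on D N : Prop :=
  [/\ linear_subspace D,
      (forall u, D u -> 0 <= N u),
      (forall u, D u -> N u = 0 -> u = 0),
      (forall (k : R) u, D u -> N (k *: u) = `|k| * N u) &
      (forall u v, D u -> D v -> N (u + v) <= N u + N v)].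

Definition equivalent_norms_on D N1 N2 : Prop :=
  exists C1 C2 : R, [/\ 0 < C1, 0 < C2 &
    forall u, D u -> C1 * N1 u <= N2 u /\ N2 u <= C2 * N1 u].

(* The complement of S in D is open for the balls of N. *)
Definition norm_closed_in D N S : Prop :=
  S `<=` D /\
  forall u, D u -> ~ S u ->
    exists2 e : R, 0 < e & forall v, D v -> N (v - u) < e -> ~ S v.

End normed_subspaces.

Section dirichlet.
Context {R : realType}.
Implicit Types (p c a t : R) (w u v f : R -> R).

Definition Rpos : set R := `]0, +oo[.

(* A function R_+ -> R is represented by its extension by 0 to R, so that
   equality of functions R -> R is equality on R_+ and these functions form a
   linear subspace of R -> R. *)
Definition fun_on_Rpos : set (R -> R) := [set u | forall t, t <= 0 -> u t = 0].

Definition abs_continuous_on (a b : R) f : Prop :=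
  forall e : R, 0 < e -> exists2 d : R, 0 < d &
    forall (n : nat) (x y : 'I_n -> R),
      (forall i, a <= x i /\ x i < y i /\ y i <= b) ->
      trivIset [set: 'I_n] (fun i => `]x i, y i[%classic) ->
      \sum_(i < n) (y i - x i) < d ->
      \sum_(i < n) `|f (y i) - f (x i)| < e.

Definition loc_abs_continuous f : Prop :=
  forall a b : R, 0 < a -> a <= b -> abs_continuous_on a b f.

Definition weighted_Lpnorm p w f : \bar R :=
  ((\int[lebesgue_measure]_(t in Rpos) (`|f t| `^ p * w t)%:E) `^ p^-1)%E.

(* Only the values of a function on R_+ matter here. *)
Definition weighted_Lp p w : set (R -> R) :=
  [set v | measurable_fun Rpos v /\ (weighted_Lpnorm p w v < +oo)%E].

(* derive1 u is total: it is the derivative wherever u is differentiable, hence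
   almost everywhere on R_+ when u is locally absolutely continuous, and its
   values on the remaining null set do not affect the norm. *)
Definition dirichlet p w : set (R -> R) :=
  [set u | [/\ fun_on_Rpos u, loc_abs_continuous u &
               (weighted_Lpnorm p w (derive1 u) < +oo)%E]].

Definition dirichlet_norm p w a u : R :=
  fine (weighted_Lpnorm p w (derive1 u)) + `|u a|.

Definition Bp_infty p w : Prop :=
  (\int[lebesgue_measure]_(t in `[1%R, +oo[) (w t `^ (- (p - 1)^-1))%:E
     < +oo)%E.

Definition Omega_infty p w t : R :=
  (\int[lebesgue_measure]_(s in `]t, +oo[) (w s `^ (- (p - 1)^-1)))
    `^ (1 - p^-1).

(* u(t) = \int_t^oo v + c on R_+.  When w is in B_p(oo), a function v in the
   weighted L^p space is integrable on each ]t, +oo[ by Hoelder's inequality,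
   so the total real-valued integral never takes its default value. *)
Definition tail_integral v c u : Prop :=
  forall t, 0 < t ->
    u t = (\int[lebesgue_measure]_(s in `]t, +oo[) v s) + c.

Definition calR_infty p w c : set (R -> R) :=
  [set u | dirichlet p w u /\ exists2 v, weighted_Lp p w v & tail_integral v c u].

Definition calA_infty p w c : set (R -> R) :=
  [set u | dirichlet p w u /\
     exists t_ : R^nat, [/\ (forall n, 0 < t_ n), nondecreasing_seq t_,
       t_ n @[n --> \oo] --> +oo & u (t_ n) @[n --> \oo] --> c]].

Definition calB_infty p w c : set (R -> R) :=
  [set u | dirichlet p w u /\ u t @[t --> +oo] --> c].

Definition calC_infty p w c : set (R -> R) :=
  [set u | [/\ dirichlet p w u,
     (u t - c) / Omega_infty p w t @[t --> +oo] --> (0 : R) &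
     (ereal_sup [set ((u t - c) / Omega_infty p w t)%:E | t in Rpos] < +oo)%E]].

Definition Tr_infty u : R := lim (u t @[t --> +oo]).

Definition dirichlet_norm_infty p w u : R :=
  fine (weighted_Lpnorm p w (derive1 u)) + `|Tr_infty u|.

End dirichlet.

(* Main.v *)
From HB Require Import structures.
From mathcomp Require Import all_boot all_order all_algebra.
From mathcomp Require Import all_classical all_reals all_analysis.
From mathcomp Require Import measurable_realfun lra ring.
Require Import Defs.

Set Implicit Arguments.
Unset Strict Implicit.
Unset Printing Implicit Defensive.

Import Order.TTheory GRing.Theory Num.Theory.
Import numFieldNormedType.Exports.

Local Open Scope classical_set_scope.
Local Open Scope ring_scope.

(** Every u in the Dirichlet space is locally absolutely continuous, so
    u(y) - u(x) is the integral of u' over ]x, y].  Hoelder's inequality for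
    the factorization u' = (u' w^(1/p)) * w^(-1/p) gives, for any measurable
    part D of R_+,

      int_D |u'| <= (int_D |u'|^p w)^(1/p) (int_D w^(-1/(p-1)))^(1-1/p),

    which is hoelder_weighted.  For D = ]t, oo[ the last factor is Omega(t),
    finite because w is in B_p(oo).  Hence u' is integrable at infinity,
    u(t) = c - int_t^oo u' for some c (dirichlet_calR), and

      |u(t) - c| <= N(t) Omega(t),   N(t) = (int_t^oo |u'|^p w)^(1/p),

    where N(t) is at most the norm of u' and tends to 0.  All four parts of
    the theorem follow from this estimate.  It places u in the set C for the
    constant c.  Conversely Omega is positive and nonincreasing, hence bounded
    near infinity, so membership in C forces u - c -> 0; and membership in A
    determines c because u has a limit (calR_calC, calC_calB, calB_calA,
    calA_calR).  The bound |u(a) - Tr u| <= ||u'|| Omega(a) compares the norms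
    (dirichlet_norm_le), so Tr is continuous for each of them, and the set of
    index c is the closed level set Tr = c.

    What this argument rests on is Lebesgue's theorem that an absolutely
    continuous function is the integral of its almost everywhere derivative
    (is_primitive_derivative_limsup), and the converse
    (is_primitive_loc_abs_continuous).  If u is
    absolutely continuous on [a, b], so is its total variation T from a, and
    u = T - (T - u) is a difference of nondecreasing absolutely continuous
    functions.  The Stieltjes measure of such a function is dominated by the
    Lebesgue measure: a null set lies in an open set of small measure, that
    set is a disjoint union of intervals, and absolute continuity bounds the
    increments over finitely many of them.  The Radon-Nikodym theorem then
    gives a density (abs_continuous_density), and the Lebesgue differentiation
    theorem identifies the density with the derivative.

    The derivative enters only through functions g of which u is a primitive
    (is_primitive).  They can be added and scaled, whereas the total
    derivative is an arbitrary function on a null set; dirichletP and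
    dirichlet_primitive_norm translate between the two descriptions. *)

(** * Finite families of disjoint intervals *)

Section absolute_continuity.
Context {R : realType}.
Implicit Types (a b c x y : R) (f : R -> R) (s : seq (R * R)).

(** The family indexed by an ordinal in the definition of absolute continuity
    becomes a list of pairs of endpoints: lists can be concatenated, which is
    how intervals are subdivided below. *)
Definition apart (i j : R * R) := (i.2 <= j.1) || (j.2 <= i.1).

Definition subinterval a b (i : R * R) := [&& a <= i.1, i.1 < i.2 & i.2 <= b].

Definition total_length s := \sum_(i <- s) (i.2 - i.1).

Definition total_increment f s := \sum_(i <- s) `|f i.2 - f i.1|.

Lemma disjoint_apart (i j : R * R) : i.1 < i.2 -> j.1 < j.2 ->
  `]i.1, i.2[ `&` `]j.1, j.2[ = set0 -> apart i j.
Proof.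
move=> i12 j12 /seteqP[+ _]; rewrite /apart.
apply: contraPT; rewrite negb_or -!ltNge => /andP[ji ij].
pose m := Num.max i.1 j.1; pose M := Num.min i.2 j.2.
have mM : m < M by rewrite /m /M gt_max !lt_min; apply/andP; split; apply/andP.
move=> /(_ ((m + M) / 2))/=; apply; rewrite !in_itv/=.
have : i.1 <= m by rewrite /m le_max lexx.
have : j.1 <= m by rewrite /m le_max lexx orbT.
have : M <= i.2 by rewrite /M ge_min lexx.
have : M <= j.2 by rewrite /M ge_min lexx orbT.
by move=> *; split; apply/andP; split; lra.
Qed.

Lemma abs_continuous_onP a b f : abs_continuous_on a b f <->
  forall e, 0 < e -> exists2 d, 0 < d & forall s,
    all (subinterval a b) s -> pairwise apart s ->
    total_length s < d -> total_increment f s < e.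
Proof.
split.
  move=> acf e /acf[d d0 {}acf]; exists d => // s /allP sab sapart sd.
  pose i0 : R * R := (0, 0).
  have := acf (size s) (fun i => (nth i0 s i).1) (fun i => (nth i0 s i).2).
  rewrite /total_increment (big_nth i0) big_mkord; apply.
  - move=> i; have /sab/and3P[-> ->//] : nth i0 s i \in s by rewrite mem_nth.
  - apply/trivIsetP => i j _ _ ij.
    wlog lt_ij : i j ij / (i < j)%N.
      move=> H; case: (ltngtP i j) => [|ji|/val_inj/eqP]; first exact: H.
        by rewrite setIC H// eq_sym.
      by rewrite (negbTE ij).
    have /(pairwiseP i0)/(_ i j (ltn_ord i) (ltn_ord j) lt_ij) := sapart.
    rewrite /apart => ap; rewrite -subset0 => z [/=].
    rewrite !in_itv/= => /andP[iz zi] /andP[jz zj].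
    by case/orP: ap => h; lra.
  - by move: sd; rewrite /total_length (big_nth i0) big_mkord.
move=> acf e /acf[d d0 {}acf]; exists d => // n x y xy tI sd.
pose s := [seq (x i, y i) | i <- enum 'I_n].
have -> : \sum_(i < n) `|f (y i) - f (x i)| = total_increment f s.
  by rewrite /total_increment big_map big_enum.
apply: acf.
- by apply/allP => _ /mapP[i _ ->]; have [? [? ?]] := xy i; apply/and3P.
- rewrite pairwise_map.
  have : uniq (enum 'I_n) by exact: enum_uniq.
  rewrite uniq_pairwise; apply: sub_pairwise => i j /= ij.
  have [? [? ?]] := xy i; have [? [? ?]] := xy j.
  by apply: disjoint_apart => //=; move/trivIsetP: tI => /(_ i j); exact.
- by rewrite /total_length big_map big_enum.
Qed.

(** A partition of [x, y], as used to define the variation, read as the list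
    of its consecutive intervals. *)
Lemma partition_subintervals x y (l : seq R) : itv_partition x y l ->
  let s := [seq (i.2, i.1) | i <- zip l (x :: l)] in
  [/\ all (subinterval x y) s, pairwise apart s, total_length s = y - x &
      forall f, total_increment f s = variation x y f l].
Proof.
move=> /= xyl; set s := map _ _.
have incr f : total_increment f s = variation x y f l.
  by rewrite (variation_zip _ xyl) /total_increment big_map.
split => //.
- elim: l x xyl @s {incr} => //= z l IH x /[dup] xzl [/= /andP[xz zl] lasty].
  have zyl : itv_partition z y l by [].
  have zy := itv_partition_le zyl.
  rewrite /subinterval/= lexx xz zy/=.
  apply: sub_all (IH _ zyl) => -[p q] /and3P[/= zp -> ->].
  by rewrite (le_trans (ltW xz) zp).
- elim: l x xyl @s {incr} => //= z l IH x [/= /andP[xz zl] lasty].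
  have zyl : itv_partition z y l by [].
  rewrite IH// andbT; apply/allP => -[p q] /mapP[[q' p'] pq /= [-> ->]].
  rewrite /apart/=; apply/orP; left.
  have : p' \in z :: l.
    elim: l (z) pq {IH zl lasty zyl xz} => //= h l IH z'.
    rewrite inE => /orP[/eqP[_ ->]|/IH h']; first by rewrite mem_head.
    by rewrite inE h' orbT.
  rewrite inE => /orP[/eqP -> //|p'l].
  by move: zl; rewrite lt_path_sortedE => /andP[/allP/(_ _ p'l)/ltW].
- elim: l x xyl @s {incr} => [x /itv_partition_nil ->|z l IH x].
    by rewrite /total_length big_nil subrr.
  move=> [/= /andP[xz zl] lasty]; rewrite /total_length/= big_cons/=.
  have zyl : itv_partition z y l by [].
  by have := IH _ zyl; rewrite /total_length => ->; lra.
Qed.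

End absolute_continuity.

(** * Total variation of an absolutely continuous function *)

Section variation_of_absolutely_continuous.
Context {R : realType}.
Implicit Types (a b x y : R) (f : R -> R) (s : seq (R * R)).

Lemma near_total_variation a b f e : a < b -> bounded_variation a b f ->
  0 < e -> exists2 l, itv_partition a b l &
    fine (total_variation a b f) - e <= variation a b f l.
Proof.
move=> ab bvf e0.
have fin : total_variation a b f \is a fin_num.
  by apply/bounded_variationP => //; exact: ltW.
have [_ [_ [l abl <-] <-]] := ub_ereal_sup_adherent e0 fin.
move=> h; exists l => //; rewrite -lee_fin EFinB fineK//; exact: ltW.
Qed.

Definition variation_from a f x := fine (total_variation a x f).

Lemma variation_fromB a b f x y : bounded_variation a b f ->
  a <= x -> x <= y -> y <= b ->
  variation_from a f y - variation_from a f x = fine (total_variation x y f).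
Proof.
move=> bvf ax xy yb; rewrite /variation_from (total_variationD f ax xy).
have bvx : bounded_variation a x f.
  exact: (bounded_variationl ax (le_trans xy yb)).
have bvxy : bounded_variation x y f.
  apply: (bounded_variationr ax) => //.
  by apply: (bounded_variationl (le_trans ax xy) yb).
by rewrite fineD; [rewrite addrAC subrr add0r|apply/bounded_variationP..].
Qed.

(** Partitioning each interval of a disjoint family finely enough turns
    increments of the total variation into increments of f, up to e for each
    interval, without changing the total length.  The last clause serves the
    induction: it keeps the pieces of one interval apart from the others. *)
Lemma refine_subintervals a b f e s : bounded_variation a b f -> 0 < e ->
  all (subinterval a b) s -> pairwise apart s ->
  exists s', [/\ all (subinterval a b) s', pairwise apart s',
    total_length s' = total_length s,
    total_increment (variation_from a f) s <=
      total_increment f s' + e * (size s)%:R &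
    forall j, j \in s' -> exists2 i, i \in s & subinterval i.1 i.2 j].
Proof.
move=> bvf e0; elim: s => [_ _|[x y] s IH /= /andP[/and3P[/= ax xy yb] sab]].
  exists [::]; split => //; rewrite /total_increment ?big_nil//= mulr0 addr0//.
move=> /andP[/allP xys aps].
have [s1 [s1ab aps1 len1 incr1 sub1]] := IH sab aps.
have bvxy : bounded_variation x y f.
  apply: (bounded_variationr ax (ltW xy)).
  by apply: (bounded_variationl _ yb) => //; rewrite (le_trans ax)// ltW.
have [l xyl lv] := near_total_variation xy bvxy e0.
have [s2xy aps2 len2 incr2] := partition_subintervals xyl.
set s2 := map _ _ in s2xy aps2 len2 incr2.
exists (s2 ++ s1); split.
- rewrite all_cat s1ab andbT; apply: sub_all s2xy => -[p q] /and3P[/= xp pq qy].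
  by rewrite /subinterval/= (le_trans ax xp) pq (le_trans qy yb).
- rewrite pairwise_cat aps1 aps2 !andbT; apply/allrelP => j k js2 /sub1[i is1].
  move=> /and3P[ik _ ki]; move/allP: s2xy => /(_ _ js2)/and3P[xj jxy jy].
  have /orP[/= h|/= h] := xys _ is1; apply/orP; [left|right].
    exact: le_trans jy (le_trans h ik).
  exact: le_trans ki (le_trans h xj).
- rewrite /total_length big_cat/= big_cons/= -/(total_length s2).
  by rewrite len2 -/(total_length s1) len1.
- rewrite /total_increment big_cat/= big_cons/= -/(total_increment f s2).
  rewrite (variation_fromB bvf)//; last exact: ltW.
  rewrite ger0_norm; last by rewrite fine_ge0// total_variation_ge0// ltW.
  rewrite incr2 -natr1 mulrDr mulr1.
  by move: incr1 lv; rewrite /total_increment; lra.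
- move=> j; rewrite mem_cat => /orP[js2|/sub1[i is1 ij]]; last first.
    by exists i => //; rewrite inE is1 orbT.
  by exists (x, y); [rewrite mem_head|move/allP: s2xy; exact].
Qed.

(** By refinement, a small increment of the variation over a disjoint family
    is, up to an arbitrarily small error, an increment of f over a family of
    the same total length. *)
Lemma abs_continuous_on_variation_from a b f : bounded_variation a b f ->
  abs_continuous_on a b f -> abs_continuous_on a b (variation_from a f).
Proof.
move=> bvf /abs_continuous_onP acf; apply/abs_continuous_onP => e e0.
have [|d d0 {}acf] := acf (e / 2); first lra.
exists d => // s sab aps sd; apply: (@le_lt_trans _ _ (e / 2)); last lra.
apply/ler_addgt0Pr => h h0.
have e1 : 0 < h / (size s).+1%:R by rewrite divr_gt0.
have [s' [s'ab aps' len' incr' _]] := refine_subintervals bvf e1 sab aps.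
apply: (le_trans incr'); apply: lerD; first by rewrite ltW// acf// len'.
by rewrite -mulrA ler_piMr ?ltW// mulrC ltr_pdivrMr// mul1r ltr_nat.
Qed.

(** Over an interval shorter than the d associated with e = 1 the variation is
    at most 1, and finitely many such intervals cover [a, b]. *)
Lemma abs_continuous_on_bounded_variation a b f : a <= b ->
  abs_continuous_on a b f -> bounded_variation a b f.
Proof.
move=> ab /abs_continuous_onP/(_ 1 ltr01)[d d0 acf].
have short x y : a <= x -> x <= y -> y <= b -> y - x < d ->
    bounded_variation x y f.
  move=> ax xy yb xyd; exists 1 => _ [l xyl <-].
  have [sab aps len <-] := partition_subintervals xyl.
  rewrite ltW// acf// ?len//.
  apply: sub_all sab => -[p q] /and3P[/= xp pq qy].
  by rewrite /subinterval/= (le_trans ax xp) pq (le_trans qy yb).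
(* Any n with (b - a) / (n + 1) < d would do. *)
pose n := Num.truncn ((b - a) / d).
have ban : (b - a) / n.+1%:R < d.
  rewrite ltr_pdivrMr// mulrC -ltr_pdivrMr//; exact: truncnS_gt.
pose x k := a + (b - a) / n.+1%:R * k%:R.
have x0 : x 0 = a by rewrite /x mulr0 addr0.
have xS k : x k.+1 = x k + (b - a) / n.+1%:R.
  by rewrite /x -[k.+1%:R]natr1 mulrDr mulr1 addrA.
have step0 : 0 <= (b - a) / n.+1%:R by rewrite divr_ge0// subr_ge0.
have xn : x n.+1 = b by rewrite /x mulfVK// addrC subrK.
have xge k : a <= x k by rewrite /x lerDl mulr_ge0.
have xle k : (k <= n.+1)%N -> x k <= b.
  by move=> kn; rewrite -xn /x lerD2l ler_wpM2l// ler_nat.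
suff H k : (k <= n.+1)%N -> bounded_variation a (x k) f.
  by rewrite -xn; exact: H.
elim: k => [_|k IH kn]; first by rewrite x0; exact: bounded_variationxx.
have xk : x k <= x k.+1 by rewrite xS lerDl.
apply/bounded_variationP => //; rewrite (total_variationD f (xge k) xk).
rewrite fin_numD; apply/andP; split; apply/bounded_variationP => //.
  exact: IH (ltnW kn).
by apply: short => //; [exact: xle|rewrite xS addrAC subrr add0r].
Qed.

End variation_of_absolutely_continuous.

(** * The density of an absolutely continuous function *)

Section density_of_absolutely_continuous.
Context {R : realType}.
Implicit Types (a b c x y : R) (f F : R -> R) (s : seq (R * R)).
Notation mu := (@lebesgue_measure R).

Lemma abs_continuous_on_uniform a b f : abs_continuous_on a b f ->
  forall e, 0 < e -> exists2 d, 0 < d & forall x y, a <= x -> x <= y -> y <= b ->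
    y - x < d -> `|f y - f x| < e.
Proof.
move=> /abs_continuous_onP acf e e0; have [d d0 {}acf] := acf e e0.
exists d => // x y ax; rewrite le_eqVlt => /predU1P[->|xy] yb xyd.
  by rewrite subrr normr0.
have := acf [:: (x, y)]; rewrite /total_increment /total_length !big_seq1/=.
by apply => //; rewrite andbT; apply/and3P.
Qed.

(** Stieltjes measures are defined from functions on the whole line; composing
    with the projection onto [a, b] extends a function by constants. *)
Definition clamp a b x := Num.max a (Num.min x b).

Lemma clamp_id a b x : a <= x -> x <= b -> clamp a b x = x.
Proof. by move=> ax xb; rewrite /clamp min_l// max_r. Qed.

Lemma clamp_itv a b x : a <= b -> a <= clamp a b x <= b.
Proof. by move=> ab; rewrite /clamp le_max lexx/= ge_max ab ge_min lexx orbT. Qed.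

Lemma clamp_nondecreasing a b : {homo clamp a b : x y / x <= y}.
Proof.
move=> x y xy; rewrite /clamp ge_max le_max lexx/= le_max; apply/orP; right.
by rewrite le_min !ge_min xy lexx orbT.
Qed.

Lemma clamp_contracting a b x y : x <= y -> clamp a b y - clamp a b x <= y - x.
Proof.
move=> xy; rewrite /clamp /Num.max /Num.min.
by do ![case: ifPn => //]; rewrite -?leNgt => *; lra.
Qed.

Lemma continuous_clamp a b f : a <= b -> abs_continuous_on a b f ->
  continuous (f \o clamp a b).
Proof.
move=> ab /abs_continuous_on_uniform acf x.
apply/cvgrPdist_lt => e /acf[d d0 {}acf]; near=> y => /=.
have yxd : `|x - y| < d by near: y; apply/nbhs_ballP; exists d.
have [/andP[ax xb] /andP[ay yb]] := (clamp_itv x ab, clamp_itv y ab).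
have [xy|yx] := leP x y.
  rewrite distrC; apply: acf => //; first exact: clamp_nondecreasing.
  apply: le_lt_trans (clamp_contracting _ _ xy) _.
  by rewrite -(ger0_norm (_ : 0 <= y - x)) ?subr_ge0// distrC.
have {}yx := ltW yx.
apply: acf => //; first exact: clamp_nondecreasing.
apply: le_lt_trans (clamp_contracting _ _ yx) _.
by rewrite -(ger0_norm (_ : 0 <= x - y)) ?subr_ge0.
Unshelve. all: by end_near. Qed.

(** The trace on ]a, b] of an open interval contains its supremum only when
    that is b, and never its infimum; so it lies in a half-open interval whose
    interior is still inside I. *)
Lemma open_interval_trace a b (I : set R) : open I -> is_interval I ->
  let J := I `&` `]a, b] in J !=set0 ->
  [/\ subinterval a b (inf J, sup J), `]inf J, sup J[ `<=` I &
      J `<=` `]inf J, sup J]].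
Proof.
move=> oI iI J J0.
have lbJ : has_lbound J.
  by exists a => z [_]/=; rewrite in_itv/= => /andP[/ltW].
have ubJ : has_ubound J.
  by exists b => z [_]/=; rewrite in_itv/= => /andP[].
have infJ z : J z -> inf J < z.
  move=> [Iz]; rewrite /= in_itv/= => /andP[az zb].
  have [e /= e0 zeI] : nbhs z I by exact: open_nbhs_nbhs.
  pose z' := Num.max ((a + z) / 2) (z - e / 2).
  have z'z : z' < z by rewrite /z' gt_max; apply/andP; split; lra.
  have az' : a < z' by rewrite /z' lt_max; apply/orP; left; lra.
  have ez' : z - e / 2 <= z' by rewrite /z' le_max lexx orbT.
  apply: le_lt_trans (z'z); apply: ge_inf => //; split.
    by apply: zeI; rewrite /ball/= ltr_distl; apply/andP; split; lra.
  by rewrite /= in_itv/= az'/= (le_trans (ltW z'z)).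
have iJ : is_interval J.
  move=> u v [Iu]/=; rewrite in_itv/= => /andP[au ub].
  move=> [Iv]/=; rewrite in_itv/= => /andP[av vb] t /andP[ut tv]; split.
    by apply: (iI u v) => //; rewrite ut.
  by rewrite /= in_itv/= (lt_le_trans au ut) (le_trans tv vb).
split.
- have [z Jz] := J0; apply/and3P; split => /=.
  + by apply: lb_le_inf => // t [_]/=; rewrite in_itv/= => /andP[/ltW].
  + by rewrite (lt_le_trans (infJ _ Jz))// ub_le_sup.
  + by apply: ge_sup => // t [_]/=; rewrite in_itv/= => /andP[].
- move=> z; rewrite /= in_itv/= => /andP[iz zs].
  have [u Ju uz] := inf_lt J0 iz; have [v Jv zv] := sup_gt J0 zs.
  by have [] : J z by apply: (iJ u v) => //; rewrite !ltW.
- by move=> z Jz; rewrite /= in_itv/= infJ// ub_le_sup.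
Qed.

End density_of_absolutely_continuous.

Section density_of_nondecreasing.
Context {R : realType}.
Implicit Types (a b c x y : R) (f F : R -> R) (s : seq (R * R)).
Notation mu := (@lebesgue_measure R).

Lemma stieltjes_measure_itv (G : cumulative R R) x y : x <= y ->
  lebesgue_stieltjes_measure G `]x, y]%classic = (G y - G x)%:E.
Proof.
move=> xy; rewrite /lebesgue_stieltjes_measure /measure_extension.
by rewrite measurable_mu_extE/= ?wlength_itv_bnd//; exact: is_ocitv.
Qed.

Section stieltjes_density.
Variables (a b : R) (F : R -> R) (G : cumulative R R).
Hypotheses (ab : a < b) (acF : abs_continuous_on a b F).
Hypothesis GF : forall x, a <= x -> x <= b -> G x = F x.

Let D : set R := `]a, b].
Let mD : measurable (D : set (measurableTypeR R)). Proof. exact: measurable_itv. Qed.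
Let Dfin : (lebesgue_stieltjes_measure G D < +oo)%E.
Proof. by rewrite stieltjes_measure_itv ?ltry// ltW. Qed.

(** The Stieltjes measure is restricted to ]a, b] because the Radon-Nikodym
    theorem is applied to a finite measure. *)
Definition trace_measure := mfrestr mD Dfin.
HB.instance Definition _ := Measure.on trace_measure.
HB.instance Definition _ := FiniteMeasure.on trace_measure.

(** An open set is a countable disjoint union of open intervals.  Their traces
    on ]a, b] form disjoint families of total length at most mu U, to which
    absolute continuity applies; the bound is uniform in the number of
    intervals kept. *)
Lemma trace_measure_open e : 0 < e -> exists2 d, 0 < d &
  forall U, open U -> (mu U < d%:E)%E -> (trace_measure U <= e%:E)%E.
Proof.
move=> e0; have [d d0 smallF] := (abs_continuous_onP a b F).1 acF e e0.
exists d => // U oU Ud.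
pose I := open_disjoint_itv oU.
have oI k : open (I k) by exact: open_disjoint_itv_open.
have iI k : is_interval (I k) by exact: open_disjoint_itv_is_interval.
have mI k : measurable (I k) by exact: open_measurable.
have tI : trivIset setT I by exact: open_disjoint_itv_trivIset.
have UI : U = \bigcup_k I k by exact: open_disjoint_itv_bigcup.
pose J k := I k `&` D.
pose p k := (inf (J k), sup (J k)).
have trace k : J k !=set0 -> [/\ subinterval a b (p k),
    `](p k).1, (p k).2[ `<=` I k & J k `<=` `](p k).1, (p k).2]].
  exact: open_interval_trace.
have tr_cvg :
    (\sum_(0 <= k < n) trace_measure (I k))%E @[n --> \oo] --> trace_measure U.
  rewrite UI; apply: measure_semi_sigma_additive => //.
  by rewrite -UI; exact: open_measurable.
have mu_cvg : (\sum_(0 <= k < n) mu (I k))%E @[n --> \oo] --> mu U.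
  rewrite UI; apply: measure_semi_sigma_additive => //.
  by rewrite -UI; exact: open_measurable.
rewrite -(cvg_lim _ tr_cvg)//; apply: lime_le.
  by apply/cvg_ex; eexists; exact: tr_cvg.
apply: nearW => n.
pose s := [seq p k | k <- iota 0 n & `[< J k !=set0 >]].
have big_s (h : R * R -> R) : \sum_(i <- s) h i =
    \sum_(0 <= k < n) if `[< J k !=set0 >] then h (p k) else 0.
  by rewrite big_map big_filter [LHS]big_mkcond/= /index_iota subn0.
apply: (@le_trans _ _ (total_increment F s)%:E); last first.
  rewrite lee_fin ltW//; apply: smallF.
  - apply/allP => i /mapP[k]; rewrite mem_filter => /andP[/asboolP Jk _] ->.
    by have [] := trace k Jk.
  - rewrite pairwise_map; have : uniq [seq k <- iota 0 n | `[< J k !=set0 >]].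
      by rewrite filter_uniq// iota_uniq.
    rewrite uniq_pairwise.
    apply: (sub_in_pairwise (P := [pred k | `[< J k !=set0 >]]));
      last exact: filter_all.
    move=> k l /asboolP Jk /asboolP Jl kl.
    have [/and3P[_ pk _] pI _] := trace _ Jk.
    have [/and3P[_ pl _] pI' _] := trace _ Jl.
    apply: disjoint_apart => //; apply/seteqP; split => // z [/pI Ikz /pI' Ilz].
    by move/trivIsetP: tI => /(_ k l Logic.I Logic.I kl)/seteqP[/(_ z)+ _]; apply.
  - rewrite -lte_fin; apply: le_lt_trans Ud.
    apply: (@le_trans _ _ (\sum_(0 <= k < n) mu (I k))%E).
      rewrite /total_length big_s -sumEFin; apply: lee_sum => k _.
      case: ifPn => [/asboolP Jk|//].
      have [/and3P[_ pk _] pI _] := trace _ Jk.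
      apply: (@le_trans _ _ (mu `](p k).1, (p k).2[)); last first.
        by rewrite le_measure ?inE//; exact: mI.
      by rewrite lebesgue_measure_itv/= lte_fin pk EFinB.
    rewrite -(cvg_lim _ mu_cvg)//.
    by apply: (nneseries_lim_ge n) => // k _ .
rewrite /total_increment big_s -sumEFin; apply: lee_sum => k _.
rewrite /trace_measure /mfrestr /mrestr -/(J k).
case: ifPn => [/asboolP Jk|/asboolP/set0P/negP/negPn/eqP ->]; last first.
  by rewrite measure0.
have [/and3P[ap pk pb] _ Jp] := trace _ Jk.
apply: (@le_trans _ _ (lebesgue_stieltjes_measure G `](p k).1, (p k).2])).
  rewrite le_measure ?inE//; first by apply: measurableI; [exact: mI|].
rewrite stieltjes_measure_itv ?(ltW pk)// lee_fin.
rewrite !GF//; first exact: ler_norm.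
- exact: le_trans (ltW pk) pb.
- exact: le_trans ap (ltW pk).
Qed.

(** By outer regularity a null set lies in open sets of arbitrarily small
    Lebesgue measure, hence of arbitrarily small trace measure. *)
Lemma trace_measure_dominated : trace_measure `<< mu.
Proof.
apply/null_content_dominatesP => A mA muA0.
apply/eqP; rewrite eq_le measure_ge0 andbT; apply/lee_addgt0Pr => e e0.
rewrite add0e; have [d d0 small] := trace_measure_open e0.
have [|U [oU AU UA]] := lebesgue_regularity_outer mA _ d0; first by rewrite muA0.
have mU : measurable U by exact: open_measurable.
apply: (@le_trans _ _ (trace_measure U)).
  by rewrite le_measure ?inE//; exact: mU.
apply: small => //; rewrite -(setDUK AU) measureU//.
- by rewrite muA0 add0e.
- exact: measurableD.
- by rewrite setDE setICA setICr setI0.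
Qed.

Lemma trace_measure_density : exists2 g : R -> R,
  mu.-integrable setT (EFin \o g) &
  forall x y, a <= x -> x <= y -> y <= b ->
    (F y - F x)%:E = (\int[mu]_(t in `]x, y]) (g t)%:E)%E.
Proof.
pose nu := charge_of_finite_measure trace_measure.
have numu : nu `<< mu by exact: trace_measure_dominated.
have gE : EFin \o (fine \o Radon_Nikodym nu mu) = Radon_Nikodym nu mu.
  by apply/funext => x /=; rewrite fineK// Radon_Nikodym_fin_num.
exists (fine \o Radon_Nikodym nu mu).
  by rewrite gE; exact: Radon_Nikodym_integrable.
move=> x y ax xy yb.
under eq_integral do
  rewrite -[(_ _)%:E]/((EFin \o (fine \o Radon_Nikodym nu mu)) _) gE.
rewrite -Radon_Nikodym_integral//.
rewrite -[RHS]/(lebesgue_stieltjes_measure G (`]x, y]%classic `&` D)).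
rewrite setIidl; last by apply: subset_itv; rewrite bnd_simp.
by rewrite stieltjes_measure_itv// !GF// ?(le_trans ax xy)// (le_trans xy yb).
Qed.

End stieltjes_density.

Lemma nondecreasing_abs_continuous_density a b F : a < b ->
  {in `[a, b] &, nondecreasing_fun F} -> abs_continuous_on a b F ->
  exists2 g : R -> R, mu.-integrable setT (EFin \o g) &
  forall x y, a <= x -> x <= y -> y <= b ->
    (F y - F x)%:E = (\int[mu]_(t in `]x, y]) (g t)%:E)%E.
Proof.
move=> ab ndF acF; pose G := F \o clamp a b.
have ndG : nondecreasing_fun G.
  move=> x y xy; apply: ndF; rewrite ?in_itv/= ?clamp_itv// ?(ltW ab)//.
  exact: clamp_nondecreasing.
have rcG : right_continuous G.
  by apply: right_continuousW; apply: continuous_clamp => //; exact: ltW.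
pose cG : cumulative R R := HB.pack G (isCumulative.Build R _ R G ndG rcG).
apply: (@trace_measure_density a b F cG ab acF) => x ax xb.
by rewrite /= /G /= clamp_id.
Qed.

(** Write f = T - (T - f) with T the total variation of f from a. *)
Lemma abs_continuous_density a b f : a < b -> abs_continuous_on a b f ->
  exists2 g : R -> R, mu.-integrable setT (EFin \o g) &
  forall x y, a <= x -> x <= y -> y <= b ->
    (f y - f x)%:E = (\int[mu]_(t in `]x, y]) (g t)%:E)%E.
Proof.
move=> ab acf; pose T := variation_from a f.
have bvf := abs_continuous_on_bounded_variation (ltW ab) acf.
have acT : abs_continuous_on a b T by exact: abs_continuous_on_variation_from.
have acTf : abs_continuous_on a b (T \- f).
  move=> e e0; have e2 : 0 < e / 2 by lra.
  have [d1 d10 acT'] := acT _ e2; have [d2 d20 acf'] := acf _ e2.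
  exists (Num.min d1 d2); first by rewrite lt_min d10.
  move=> n x y xy tI; rewrite lt_min => /andP[xyd1 xyd2].
  have := acT' n x y xy tI xyd1; have := acf' n x y xy tI xyd2.
  move=> hf hT; rewrite (splitr e); apply: le_lt_trans (ltrD hT hf).
  rewrite -big_split/=; apply: ler_sum => i _.
  apply: le_trans (ler_normB _ _); rewrite le_eqVlt; apply/orP; left.
  by apply/eqP; congr `|_|; rewrite /=; lra.
have TB x y : a <= x -> x <= y -> y <= b ->
    T y - T x = fine (total_variation x y f).
  exact: variation_fromB.
have ndT : {in `[a, b] &, nondecreasing_fun T}.
  move=> x y; rewrite !in_itv/= => /andP[ax xb] /andP[ay yb] xy.
  by rewrite -subr_ge0 TB// fine_ge0// total_variation_ge0.
have ndTf : {in `[a, b] &, nondecreasing_fun (T \- f)}.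
  move=> x y; rewrite !in_itv/= => /andP[ax xb] /andP[ay yb] xy.
  suff : f y - f x <= T y - T x by lra.
  rewrite TB// (le_trans (ler_norm _))// -lee_fin fineK.
    exact: total_variation_ge.
  apply/bounded_variationP => //; apply: (bounded_variationr ax) => //.
  exact: bounded_variationl bvf.
have [g ig gE] := nondecreasing_abs_continuous_density ab ndT acT.
have [h ih hE] := nondecreasing_abs_continuous_density ab ndTf acTf.
exists (g \- h).
  have -> : EFin \o (g \- h) = ((EFin \o g) \- (EFin \o h))%E by apply/funext.
  exact: integrableB.
move=> x y ax xy yb.
under eq_integral do rewrite /= EFinB.
rewrite integralB//; [|exact: integrableS ig|exact: integrableS ih].
rewrite -gE// -hE// -EFinB/=; congr EFin; lra.
Qed.

End density_of_nondecreasing.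

(** * Primitives on the half-line *)

Section primitives.
Context {R : realType}.
Implicit Types (a b c x y t : R) (f u g : R -> R).
Notation mu := (@lebesgue_measure R).

(** Almost every point is a Lebesgue point of g. *)
Lemma ae_derivable_primitive f g a b : a < b ->
  mu.-integrable `]a, b] (EFin \o g) ->
  (forall x, a <= x -> x <= b -> f x - f a = \int[mu]_(t in `]a, x]) g t) ->
  {ae mu, forall t, a < t -> t < b -> derivable f t 1 /\ derive1 f t = g t}.
Proof.
move=> ab ig fg; pose h := g \_ `]a, b].
have ih : mu.-integrable setT (EFin \o h).
  by move: ig; rewrite integrable_mkcond// restrict_EFin.
have ihy y : mu.-integrable [set` Interval (BRight a) (BRight y)] (EFin \o h).
  exact: integrableS ih.
have loch : locally_integrable [set: R] h.
  by apply: open_integrable_locally => //; exact: openT.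
have /= := FTC1 ihy loch.
apply: filterS; first exact: (ae_filter_ringOfSetsType mu).
move=> t dF at_ tb.
have [dF1 dF2] := dF at_; set F := fun x => _ in dF1 dF2.
have hg : h t = g t by rewrite /h patchE mem_set//= in_itv/= at_ ltW.
have nearf : {near t, (fun x => f a + F x) =1 f}.
  near=> x; have ax : a <= x by near: x; exact: lt_le_nbhsr.
  have xb : x <= b by near: x; exact: lt_le_nbhsl.
  rewrite -[RHS](subrK (f a)) fg// addrC; congr (_ + _).
  apply: eq_Rintegral => s; rewrite inE/= in_itv/= => /andP[sa sx].
  by rewrite /h patchE mem_set//= in_itv/= sa (le_trans sx).
have dfaF : is_derive t 1 (fun x => f a + F x) (0 + derive1 F t).
  apply: is_deriveD; rewrite derive1E; exact: DeriveDef.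
have := near_eq_is_derive nearf dfaF; rewrite add0r dF2 hg => -[df1 df2].
by rewrite derive1E.
Unshelve. all: by end_near. Qed.

(** The integrals start at x > 0 because g need not be integrable near 0. *)
Definition is_primitive u g := measurable_fun (@Rpos R) g /\
  forall x y, 0 < x -> x <= y ->
    mu.-integrable `]x, y] (EFin \o g) /\
    u y - u x = \int[mu]_(t in `]x, y]) g t.

(** Exhaust R_+ by the intervals ]1/(n+2), n+2[; the shift by 2 makes them all
    nonempty. *)
Lemma ae_Rpos (P : R -> Prop) :
  (forall a b, 0 < a -> a < b -> {ae mu, forall t, a < t -> t < b -> P t}) ->
  {ae mu, forall t, 0 < t -> P t}.
Proof.
move=> aeP.
have /ae_foralln : forall n,
    {ae mu, forall t, n.+2%:R^-1 < t -> t < n.+2%:R -> P t}.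
  move=> n; apply: aeP; first by rewrite invr_gt0.
  by rewrite (@lt_trans _ _ 1)// ?invf_lt1 ?ltr1n.
apply: filterS => t Pt t0.
pose n := maxn (Num.truncn t) (Num.truncn t^-1).
have nt : t < n.+2%:R.
  apply: lt_le_trans (truncnS_gt _) _.
  by rewrite ler_nat ltnS (leq_trans (leq_maxl _ (Num.truncn t^-1))).
have nt' : t^-1 < n.+2%:R.
  apply: lt_le_trans (truncnS_gt _) _.
  by rewrite ler_nat ltnS (leq_trans (leq_maxr (Num.truncn t) _)).
apply: (Pt n) => //; rewrite invf_plt ?posrE//.
Qed.

Lemma is_primitive_ae_derivable u g : is_primitive u g ->
  {ae mu, forall t, 0 < t -> derivable u t 1 /\ derive1 u t = g t}.
Proof.
move=> [_ ug]; apply: ae_Rpos => a b a0 ab.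
apply: ae_derivable_primitive => //; first by have [] := ug a b a0 (ltW ab).
by move=> x ax _; have [] := ug a x a0 ax.
Qed.

Definition difference_quotient u n t := n.+1%:R * (u (t + n.+1%:R^-1) - u t).

(** A function that is measurable everywhere and equals the derivative of u
    wherever u is derivable. *)
Definition derivative_limsup u t :=
  fine (limn_esup (fun n => (difference_quotient u n t)%:E)).

Lemma measurable_derivative_limsup u : measurable_fun setT u ->
  measurable_fun setT (derivative_limsup u).
Proof.
move=> mu_; apply: measurableT_comp => //.
apply: measurable_fun_limn_esup => n; apply/measurable_EFinP.
apply: measurable_funM => //; apply: measurable_funB => //.
by apply: measurableT_comp => //; exact: measurable_funD.
Qed.

Lemma derivative_limsupE u t : derivable u t 1 ->
  derivative_limsup u t = derive1 u t.
Proof.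
move=> du.
have cu : difference_quotient u n t @[n --> \oo] --> derive1 u t.
  have /cvg_ex[/= l ul] := du.
  have -> : derive1 u t = l by rewrite derive1E; exact/cvg_lim.
  have /cvg_at_rightP/(_ (fun n => n.+1%:R^-1)) := cvg_dnbhs_at_right ul.
  have := @cvg_harmonic R; rewrite /harmonic/= => h0 /(_ (conj _ h0)).
  under eq_fun do rewrite invrK /GRing.scale/= mulr1 [_ + t]addrC.
  by apply.
rewrite /derivative_limsup is_cvg_limn_esupE; last first.
  by apply/cvg_ex; exists (derive1 u t)%:E; apply/cvg_EFin => //; exact: nearW.
have /cvg_lim -> // :
    (difference_quotient u n t)%:E @[n --> \oo] --> (derive1 u t)%:E.
by apply/cvg_EFin => //; exact: nearW.
Qed.

Lemma loc_abs_continuous_continuous u : loc_abs_continuous u ->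
  {in (@Rpos R), continuous u}.
Proof.
move=> acu t; rewrite inE /Rpos/= in_itv/= andbT => t0.
have t20 : t / 2 <= t + 1 by lra.
have c := continuous_clamp t20 (acu (t / 2) (t + 1) ltac:(lra) t20).
have ct : clamp (t / 2) (t + 1) t = t by rewrite clamp_id//; lra.
rewrite /continuous_at -[in X in _ --> X]ct.
apply: cvg_trans (c t); apply: near_eq_cvg.
near=> x; rewrite /= clamp_id//.
  by near: x; apply: lt_le_nbhsr; lra.
by near: x; apply: lt_le_nbhsl; lra.
Unshelve. all: by end_near. Qed.

Lemma measurable_loc_abs_continuous u : fun_on_Rpos u ->
  loc_abs_continuous u -> measurable_fun setT u.
Proof.
move=> u0 acu; have -> : u = u \_ Rpos.
  apply/funext => t; rewrite patchE; case: ifPn => //.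
  rewrite notin_setE /Rpos/= in_itv/= andbT => /negP.
  by rewrite -leNgt; exact: u0.
have mu0 : measurable_fun (@Rpos R) u.
  by apply: open_continuous_measurable_fun;
    [exact: interval_open|exact: loc_abs_continuous_continuous].
by move: mu0; move/(measurable_restrictT _ (measurable_itv _)).1.
Qed.

(** The fundamental theorem of calculus: on ]x, y] the density of u agrees
    almost everywhere with the derivative of u. *)
Lemma is_primitive_derivative_limsup u : fun_on_Rpos u ->
  loc_abs_continuous u -> is_primitive u (derivative_limsup u).
Proof.
move=> u0 acu.
have mg := measurable_derivative_limsup (measurable_loc_abs_continuous u0 acu).
split=> [|x y x0]; first exact: measurable_funTS.
rewrite le_eqVlt => /predU1P[->|xy].
  rewrite set_itvoc0 Rintegral_set0 subrr; split => //; exact: integrable_set0.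
have [g ig ug] := abs_continuous_density xy (acu x y x0 (ltW xy)).
have igxy : mu.-integrable `]x, y] (EFin \o g) by exact: integrableS ig.
have ugR z : x <= z -> z <= y -> u z - u x = \int[mu]_(t in `]x, z]) g t.
  by move=> xz zy; rewrite /Rintegral -ug.
have aeg : ae_eq mu (`]x, y]%classic) (EFin \o g) (EFin \o derivative_limsup u).
  have := ae_derivable_primitive xy igxy ugR.
  have aey : {ae mu, forall t, t != y}.
    exists [set y]; split => //; first exact: lebesgue_measure_set1.
    by move=> t /= /negP/negPn/eqP.
  move: aey; apply: filterS2; first exact: (ae_filter_ringOfSetsType mu).
  move=> t ty du /=; rewrite in_itv/= => /andP[xt].
  rewrite le_eqVlt (negbTE ty)/= => {}ty.
  by have [{}du <-] := du xt ty; rewrite derivative_limsupE.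
have mgxy : measurable_fun (`]x, y]%classic) (EFin \o derivative_limsup u).
  by apply/measurable_EFinP; exact: measurable_funTS.
split.
  have [mgo igo] := integrableP _ _ _ igxy.
  apply/integrableP; split => //; apply: le_lt_trans igo; rewrite le_eqVlt.
  apply/orP; left; apply/eqP; apply: ge0_ae_eq_integral => //.
  - exact: measurableT_comp.
  - exact: measurableT_comp.
  - exact/ae_eq_abse/ae_eq_sym.
rewrite (ugR y (ltW xy) (lexx y)) /Rintegral; congr fine.
by apply: ae_eq_integral => //; exact: measurable_int igxy.
Qed.

Lemma is_primitiveD u v g h : is_primitive u g -> is_primitive v h ->
  is_primitive (u + v) (fun t => g t + h t).
Proof.
move=> [mg ug] [mh vh]; split=> [|x y x0 xy]; first exact: measurable_funD.
have [ig ugE] := ug x y x0 xy; have [ih vhE] := vh x y x0 xy; split.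
  have -> : EFin \o (fun t => g t + h t) = ((EFin \o g) \+ (EFin \o h))%E.
    exact/funext.
  exact: integrableD.
by rewrite RintegralD// -ugE -vhE !fctE opprD addrACA.
Qed.

Lemma is_primitiveZ k u g :
  is_primitive u g -> is_primitive (k *: u) (fun t => k * g t).
Proof.
move=> [mg ug]; split=> [|x y x0 xy]; first exact: measurable_funM.
have [ig ugE] := ug x y x0 xy; split.
  have -> : EFin \o (fun t => k * g t) = (fun t => k%:E * (EFin \o g) t)%E.
    exact/funext.
  exact: integrableZl.
by rewrite RintegralZl// -ugE !fctE mulrBr.
Qed.

Lemma is_primitive0 : is_primitive (0 : R -> R) (fun=> 0).
Proof.
split=> // x y _ _; split; last by rewrite Rintegral_cst// mul0r subrr.
exact: integrable0.
Qed.

(** The converse: the integral of |g| over a set is small when the measure of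
    the set is small. *)
Lemma is_primitive_loc_abs_continuous u g :
  is_primitive u g -> loc_abs_continuous u.
Proof.
move=> [_ ug] a b a0 ab e e0; pose h := g \_ `]a, b].
have [igab _] := ug a b a0 ab.
have ih : mu.-integrable setT (EFin \o h).
  by move: igab; rewrite integrable_mkcond// restrict_EFin.
have mh : measurable_fun setT (EFin \o h) by exact: measurable_int ih.
have [d [d0 small]] := integral_normr_continuous ih e0.
exists d => // n x y xy tI sd.
pose I (i : 'I_n) : set R := `]x i, y i[%classic.
have mI i : measurable (I i) by exact: measurable_itv.
pose D := \big[setU/set0]_(i < n) I i.
have mD : measurable D by exact: bigsetU_measurable.
have muD : mu D = (\sum_(i < n) (y i - x i))%:E.
  rewrite [LHS]measure_bigsetU_ord// -sumEFin; apply: eq_bigr => i _.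
  have [_ [xyi _]] := xy i.
  by rewrite /= lebesgue_measure_itv/= lte_fin xyi EFinB.
have sD : (mu D < d%:E)%E by rewrite muD lte_fin.
have := small D mD sD; apply: le_lt_trans.
rewrite -lee_fin /Rintegral fineK; last first.
  apply: integrable_fin_num => //.
  by apply: (integrableS measurableT) => //; exact: (integrable_norm ih).
rewrite ge0_integral_bigsetU//; last 3 first.
- exact: index_enum_uniq.
- exact: sub_trivIset tI.
- apply: measurable_funTS; do 2 apply: measurableT_comp => //.
  exact/measurable_EFinP.
rewrite -sumEFin; apply: lee_sum => i _.
have [axi [xyi ybi]] := xy i.
have [igi ->] := ug (x i) (y i) (lt_le_trans a0 axi) (ltW xyi).
rewrite /I integral_itv_bndo_bndc; last first.
  apply: measurable_funTS; do 2 apply: measurableT_comp => //.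
  exact/measurable_EFinP.
have -> : (\int[mu]_(t in `]x i, y i]) (`|h t|)%:E =
    \int[mu]_(t in `]x i, y i]) (`|g t|)%:E)%E.
  apply: eq_integral => t; rewrite inE/= in_itv/= => /andP[xt ty].
  by rewrite /h patchE mem_set//= in_itv/= (le_lt_trans axi xt) (le_trans ty ybi).
rewrite -[leRHS]fineK; first by rewrite lee_fin; exact: le_normr_Rintegral.
by apply: integrable_fin_num => //; exact: integrable_norm igi.
Qed.

End primitives.

(** * Weighted norms and Hoelder's inequality *)

Section integral_null_set.
Import HBNNSimple.
Context {R : realType}.

(** For arbitrary nonnegative f and g the integral is a supremum over the simple
    functions below, and a simple function may be set to 0 on N without
    changing its integral.  This is how the total derivative, arbitrary on a
    null set, can be replaced by a density. *)
Lemma null_set_ge0_integral d (T : measurableType d)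
    (nu : {measure set T -> \bar R}) (D N : set T) (f g : T -> \bar R) :
  measurable D -> measurable N -> nu N = 0%E ->
  (forall t, D t -> (0 <= f t)%E) -> (forall t, D t -> (0 <= g t)%E) ->
  (forall t, D t -> ~ N t -> f t = g t) ->
  (\int[nu]_(t in D) f t = \int[nu]_(t in D) g t)%E.
Proof.
move=> mD mN N0.
wlog suff : f g / (forall t, D t -> (0 <= f t)%E) ->
  (forall t, D t -> (0 <= g t)%E) ->
  (forall t, D t -> ~ N t -> f t = g t) ->
  (\int[nu]_(t in D) f t <= \int[nu]_(t in D) g t)%E.
  move=> H f0 g0 fg; apply/eqP; rewrite eq_le !H// => t Dt Nt; exact/esym/fg.
move=> f0 g0 fg; rewrite !ge0_integralE//.
apply: ge_ereal_sup => _ [h hf <-].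
pose k : {nnsfun _ >-> R} := mul_nnsfun h (indic_nnsfun R (measurableC mN)).
have kE (x : T) : k x = h x * (x \in ~` N)%:R by rewrite -indicE.
have kg : forall x : T, ((k x)%:E <= (g \_ D) x)%E.
  move=> x; rewrite kE; have [Nx|Nx] := boolP (x \in ~` N).
    rewrite mulr1; apply: le_trans (hf x) _; rewrite !patchE; case: ifPn => // Dx.
    by rewrite fg//; [rewrite inE in Dx|rewrite inE in Nx].
  by rewrite mulr0 patchE; case: ifPn => // Dx; rewrite g0//; rewrite inE in Dx.
apply: ereal_sup_ubound; exists k => //=.
rewrite -!integralT_nnsfun; apply: ge0_ae_eq_integral => //.
- exact/measurable_EFinP.
- exact/measurable_EFinP.
- by move=> x _; rewrite lee_fin.
- by move=> x _; rewrite lee_fin.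
exists N; split => // z /= /not_implyP[_]; apply: contra_notP => Nz.
by rewrite -[(_ * _)%R]/(k z) kE mem_set// mulr1.
Qed.

End integral_null_set.

Section weighted_norm.
Context {R : realType}.
Notation mu := (@lebesgue_measure R).
Variables (p : R) (w : R -> R).
Hypotheses (p_gt1 : 1 < p) (w_pos : forall t : R, 0 < t -> 0 < w t)
  (w_cont : {within Rpos, continuous w}).

Let p0 : 0 < p. Proof. exact: lt_trans p_gt1. Qed.
Let p_neq0 : p != 0. Proof. by rewrite gt_eqF. Qed.

Lemma RposP (t : R) : Rpos t <-> 0 < t.
Proof. by rewrite /Rpos/= in_itv/= andbT. Qed.

Lemma measurable_Rpos : measurable (@Rpos R). Proof. exact: measurable_itv. Qed.
Hint Resolve measurable_Rpos : core.

Lemma measurable_weight : measurable_fun (@Rpos R) w.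
Proof. exact: subspace_continuous_measurable_fun. Qed.

Lemma measurable_weight_powR (r : R) :
  measurable_fun (@Rpos R) (fun t => w t `^ r).
Proof.
by apply: (measurableT_comp (measurable_powR _)); exact: measurable_weight.
Qed.

Lemma Lnorm_restrict (D : set R) (f : R -> R) (q : R) : measurable D -> q != 0 ->
  Lnorm mu q%:E (EFin \o (f \_ D)) =
  ((\int[mu]_(t in D) (`|f t| `^ q)%:E) `^ q^-1)%E.
Proof.
move=> mD q0; rewrite unlock [in RHS]integral_mkcond/=; congr poweR.
apply: eq_integral => t _ /=.
rewrite /patch; case: ifPn => _ //; by rewrite ?normr0 ?poweR_EFin ?powR0.
Qed.

Lemma weightM t x : 0 < t -> `|x * w t `^ p^-1| `^ p = `|x| `^ p * w t.
Proof.
move=> t0; rewrite normrM powRM// (ger0_norm (powR_ge0 _ _)) -powRrM mulVf//.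
by rewrite powRr1// ltW// w_pos.
Qed.

(** The weighted norm of v is the unweighted one of v w^(1/p); this brings
    Minkowski's and Hoelder's inequalities to bear. *)
Definition weigh (v : R -> R) : R -> R := fun t => v t * w t `^ p^-1.

Lemma measurable_weigh (D : set R) (v : R -> R) :
  measurable D -> D `<=` @Rpos R ->
  measurable_fun (@Rpos R) v -> measurable_fun setT (weigh v \_ D).
Proof.
move=> mD DR mv; apply/(measurable_restrictT _ _).1 => //.
apply: measurable_funS DR _ => //.
by apply: measurable_funM => //; exact: measurable_weight_powR.
Qed.

Lemma weighted_Lpnorm_restrict (D : set R) (v : R -> R) :
  measurable D -> D `<=` @Rpos R ->
  ((\int[mu]_(t in D) (`|v t| `^ p * w t)%:E) `^ p^-1)%E =
  Lnorm mu p%:E (EFin \o (weigh v \_ D)).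
Proof.
move=> mD DR; rewrite Lnorm_restrict//; congr poweR.
by apply: eq_integral => t; rewrite inE => /DR/RposP t0; rewrite /weigh weightM.
Qed.

Lemma weighted_LpnormE v :
  weighted_Lpnorm p w v = Lnorm mu p%:E (EFin \o (weigh v \_ Rpos)).
Proof. exact: weighted_Lpnorm_restrict. Qed.

Lemma weighted_Lpnorm_ge0 v : (0 <= weighted_Lpnorm p w v)%E.
Proof. exact: poweR_ge0. Qed.

Lemma ae_eq_weighted_Lpnorm (f g : R -> R) :
  {ae mu, forall t, 0 < t -> f t = g t} ->
  weighted_Lpnorm p w f = weighted_Lpnorm p w g.
Proof.
move=> [N [mN N0 fgN]].
suff fgE : (\int[mu]_(t in Rpos) (`|f t| `^ p * w t)%:E =
    \int[mu]_(t in Rpos) (`|g t| `^ p * w t)%:E)%E by rewrite /weighted_Lpnorm fgE.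
have ge0 h t : Rpos t -> (0 <= (`|h t| `^ p * w t)%:E)%E.
  by move=> /RposP t0; rewrite lee_fin mulr_ge0// ?powR_ge0// ltW// w_pos.
apply: (@null_set_ge0_integral R _ _ mu (@Rpos R) N _ _ _ mN N0);
  [exact: measurable_Rpos|exact: ge0|exact: ge0|].
move=> t /RposP t0 Nt; congr (`|_| `^ _ * _)%:E.
by apply: contrapT => fg; apply: Nt; apply: fgN => /= /(_ t0).
Qed.

Lemma weighted_LpnormD (f g : R -> R) :
  measurable_fun (@Rpos R) f -> measurable_fun (@Rpos R) g ->
  (weighted_Lpnorm p w (f \+ g)%R <=
   weighted_Lpnorm p w f + weighted_Lpnorm p w g)%E.
Proof.
move=> mf mg; rewrite !weighted_LpnormE.
have -> : EFin \o (weigh (f \+ g) \_ Rpos) =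
    EFin \o ((weigh f \_ Rpos) \+ (weigh g \_ Rpos)).
  apply/funext => t /=; congr EFin; rewrite /patch /weigh.
  by case: ifPn => _; rewrite ?addr0// mulrDl.
by apply: minkowski_EFin; [exact: measurable_weigh..|exact: ltW].
Qed.

Lemma weighted_LpnormZ (k : R) (f : R -> R) : measurable_fun (@Rpos R) f ->
  weighted_Lpnorm p w (fun t => k * f t)%R = (`|k|%:E * weighted_Lpnorm p w f)%E.
Proof.
move=> mf; rewrite /weighted_Lpnorm.
have mF : measurable_fun (@Rpos R) (fun t => (`|f t| `^ p * w t)%:E).
  apply/measurable_EFinP; apply: measurable_funM; last exact: measurable_weight.
  by apply: (measurableT_comp (measurable_powR _)); exact: measurableT_comp.
have F0 t : Rpos t -> (0 <= (`|f t| `^ p * w t)%:E)%E.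
  by move=> /RposP t0; rewrite lee_fin mulr_ge0// ?powR_ge0// ltW// w_pos.
have k0 : (0 <= (`|k| `^ p)%:E)%E by rewrite lee_fin powR_ge0.
under eq_integral do rewrite normrM powRM// -mulrA EFinM.
rewrite ge0_integralZl//.
rewrite poweRM//; last exact: integral_ge0.
by rewrite poweR_EFin -powRrM mulfV// powRr1.
Qed.

Definition conj_weight t := w t `^ (- (p - 1)^-1).

(** Hoelder's inequality for v = (v w^(1/p)) * w^(-1/p): with q = p/(p-1) the
    q-th power of w^(-1/p) is w^(-1/(p-1)), and 1/q = 1 - 1/p. *)
Lemma hoelder_weighted (D : set R) (v : R -> R) : measurable D -> D `<=` @Rpos R ->
  measurable_fun (@Rpos R) v ->
  (\int[mu]_(t in D) `|v t|%:E <=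
   (\int[mu]_(t in D) (`|v t| `^ p * w t)%:E) `^ p^-1 *
   (\int[mu]_(t in D) (conj_weight t)%:E) `^ (1 - p^-1))%E.
Proof.
move=> mD DR mv.
have p10 : 0 < p - 1 by rewrite subr_gt0.
pose q := p / (p - 1).
have q0 : 0 < q by rewrite divr_gt0.
have qV : q^-1 = 1 - p^-1 by rewrite /q invf_div mulrBl mulfV// mul1r.
pose h t := w t `^ (- p^-1).
have mh : measurable_fun setT (h \_ D).
  apply/(measurable_restrictT _ _).1 => //.
  by apply: measurable_funS DR _ => //; exact: measurable_weight_powR.
have := hoelder mu (measurable_weigh mD DR mv) mh p0 q0.
rewrite qV addrC subrK => /(_ erefl).
rewrite -weighted_Lpnorm_restrict// Lnorm_restrict ?gt_eqF//.
have -> : (\int[mu]_(t in D) (`|h t| `^ q)%:E =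
    \int[mu]_(t in D) (conj_weight t)%:E)%E.
  apply: eq_integral => t; rewrite inE => /DR/RposP t0; congr EFin.
  rewrite /h /conj_weight ger0_norm ?powR_ge0// -powRrM; congr powR.
  by rewrite /q; field; rewrite p_neq0 gt_eqF.
rewrite qV; apply: le_trans.
rewrite integral_mkcond Lnorm1 le_eqVlt; apply/orP; left; apply/eqP.
apply: eq_integral => t _; rewrite /patch/= /patch; case: ifPn; last first.
  by rewrite mul0r normr0.
rewrite inE => /DR/RposP t0; rewrite /weigh /h -mulrA -powRD.
  by rewrite subrr powRr0 mulr1.
by apply/implyP => _; rewrite gt_eqF// w_pos.
Qed.

Lemma dirichlet_primitive_norm u g : is_primitive u g ->
  weighted_Lpnorm p w (derive1 u) = weighted_Lpnorm p w g.
Proof.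
move=> /is_primitive_ae_derivable ug; apply: ae_eq_weighted_Lpnorm.
move: ug; apply: filterS; first exact: (ae_filter_ringOfSetsType mu).
by move=> t ug /ug[].
Qed.

Lemma dirichletP u : dirichlet p w u <-> fun_on_Rpos u /\
  exists2 g, is_primitive u g & (weighted_Lpnorm p w g < +oo)%E.
Proof.
split=> [[u0 acu u'p]|[u0 [g ug gp]]].
  split => //; have ug := is_primitive_derivative_limsup u0 acu.
  exists (derivative_limsup u); first exact: ug.
  by move: u'p; rewrite (dirichlet_primitive_norm ug); exact.
split; [exact: u0|exact: is_primitive_loc_abs_continuous ug|].
by rewrite (dirichlet_primitive_norm ug); exact: gp.
Qed.

End weighted_norm.

(** * Tails at infinity *)

Section tails.
Context {R : realType}.
Notation mu := (@lebesgue_measure R).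

(** Dominated convergence for the restrictions of |f| to ]n, oo[ yields one
    small tail, which bounds all later ones. *)
Lemma integrable_tail_cvg0 (f : R -> R) a : mu.-integrable `]a, +oo[ (EFin \o f) ->
  (\int[mu]_(s in `]t, +oo[) f s)%R @[t --> +oo] --> 0.
Proof.
move=> intf; pose D : set R := `]a, +oo[%classic.
have mD : measurable D by exact: measurable_itv.
have iaf : mu.-integrable D (EFin \o (fun s => `|f s|)).
  exact: integrable_norm intf.
pose g : R -> R := (fun s => `|f s|) \_ D.
have mg : measurable_fun setT g.
  by have /measurable_EFinP/(measurable_restrictT _ mD).1 := measurable_int mu iaf.
pose f_ n : R -> \bar R := EFin \o (g \_ `]n%:R, +oo[).
have mf_ n : measurable_fun D (f_ n).
  apply: measurable_funTS; apply/measurable_EFinP.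
  have mgn : measurable_fun (`]n%:R, +oo[%classic : set R) g.
    exact: measurable_funTS.
  by move: mgn => /(measurable_restrictT _ (measurable_itv _)).1.
have f_cvg s : D s -> f_ ^~ s @ \oo --> (cst 0%E : R -> \bar R) s.
  move=> Ds; apply: cvg_near_cst; near=> n.
  rewrite /f_/= patchE memNset//= in_itv/= andbT; apply/negP; rewrite -leNgt.
  by near: n; exact: nbhs_infty_ger.
have f_g n s : D s -> (`|f_ n s| <= (`|f s|)%:E)%E.
  move=> Ds; rewrite /f_/= patchE; case: ifPn => _; last by rewrite normr0 lee_fin.
  by rewrite /g patchE mem_set// normr_id.
have ae_cvg :
    {ae mu, forall s, D s -> f_ ^~ s @ \oo --> (cst 0%E : R -> \bar R) s}.
  exact: aeW.
have ae_le : {ae mu, forall s n, D s ->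
    (`|f_ n s| <= (EFin \o (fun s => `|f s|)%R) s)%E}.
  by apply: aeW => s n; exact: f_g.
have [|||||_ _] := @dominated_convergence _ _ _ mu D mD f_ (cst 0%E)
  (EFin \o (fun s => `|f s|)).
- exact: mf_.
- exact: measurable_cst.
- exact: ae_cvg.
- exact: iaf.
- exact: ae_le.
rewrite integral0 => /fine_cvgP[int_fin /cvgr0Pnorm_lt int_cvg].
apply/cvgr0Pnorm_lt => e e0; have {int_cvg} := int_cvg e e0.
move=> /(filterI int_fin)[N _ /(_ N (leqnn N))/= [intN intNe]].
near=> t; have at_ : a <= t by near: t; apply: nbhs_pinfty_ge; exact: num_real.
have Nt : N%:R <= t by near: t; apply: nbhs_pinfty_ge; exact: num_real.
have itf : mu.-integrable `]t, +oo[ (EFin \o f).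
  by apply: integrableS intf => //; apply: subset_itvr; rewrite bnd_simp.
apply: le_lt_trans intNe; apply: le_trans (le_normr_Rintegral _ itf) _ => //.
apply: le_trans (ler_norm _); rewrite fine_le//.
  by apply: integrable_fin_num => //; exact: integrable_norm itf.
have -> : (\int[mu]_(s in `]t, +oo[) (`|f s|)%:E =
    \int[mu]_(s in `]t, +oo[) f_ N s)%E.
  apply: eq_integral => s; rewrite inE/= in_itv/= andbT => ts.
  rewrite /f_/= patchE mem_set/= ?in_itv/= ?andbT ?(le_lt_trans Nt)//.
  by rewrite /g patchE mem_set// /D/= in_itv/= andbT (le_lt_trans at_).
apply: ge0_subset_integral => //; first exact: mf_.
- by move=> s _; rewrite /f_/= lee_fin /g /patch; do ?case: ifPn.
- by apply: subset_itvr; rewrite bnd_simp.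
Unshelve. all: by end_near. Qed.

Lemma tail_integralB (f : R -> R) x y : x <= y ->
  mu.-integrable `]x, +oo[ (EFin \o f) ->
  \int[mu]_(s in `]x, +oo[) f s - \int[mu]_(s in `]y, +oo[) f s =
  \int[mu]_(s in `]x, y]) f s.
Proof.
move=> xy fi; rewrite -(Rintegral_itvB fi (x := y))//= ?bnd_simp//.
by rewrite opprB addrC subrK.
Qed.

Variables (p : R) (w : R -> R).
Hypotheses (p_gt1 : 1 < p) (w_pos : forall t : R, 0 < t -> 0 < w t)
  (w_cont : {within Rpos, continuous w}) (w_Bp : Bp_infty p w).

Let p0 : 0 < p. Proof. exact: lt_trans p_gt1. Qed.
Notation rho := (conj_weight p w).

Lemma tail_Rpos t : 0 < t -> `]t, +oo[ `<=` @Rpos R.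
Proof. by move=> t0; apply: subset_itvr; rewrite bnd_simp ltW. Qed.

Lemma measurable_conj_weight : measurable_fun (@Rpos R) rho.
Proof. exact: measurable_weight_powR. Qed.

Lemma conj_weight_gt0 t : 0 < t -> 0 < rho t.
Proof. by move=> t0; rewrite powR_gt0// w_pos. Qed.

(** On [1, oo[ this is the condition B_p(oo); on ]t, 1] the continuous function
    w has a positive minimum. *)
Lemma integrable_conj_weight t : 0 < t -> mu.-integrable `]t, +oo[ (EFin \o rho).
Proof.
move=> t0.
have rho0 s : 0 <= rho s by exact: powR_ge0.
have mt (D : set R) : D `<=` @Rpos R -> measurable_fun D (EFin \o rho).
  move=> DR; apply/measurable_EFinP.
  apply: measurable_funS DR measurable_conj_weight.
  exact: measurable_Rpos.
have i1 : mu.-integrable `[1%R, +oo[ (EFin \o rho).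
  apply/integrableP; split.
    by apply: mt; apply: subset_itvr; rewrite bnd_simp.
  apply: le_lt_trans w_Bp; rewrite le_eqVlt; apply/orP; left; apply/eqP.
  by apply: eq_integral => s _ /=; rewrite ger0_norm.
have [t1|t1'] := leP 1 t.
  by apply: integrableS i1 => //; apply: subset_itvr; rewrite bnd_simp.
have -> : `]t, +oo[%classic = (`]t, 1[ `|` `[1, +oo[)%classic.
  by rewrite -(@itv_bndbnd_setU _ _ _ (BLeft 1)) ?bnd_simp//.
have t1 := ltW t1'.
have wt1 : {within `[t, 1], continuous w}.
  apply: continuous_subspaceW w_cont; apply: subset_itv; rewrite ?bnd_simp//.
have [c] := EVT_min t1 wt1; rewrite in_itv/= => /andP[tc c1] cmin.
have c0 : 0 < c by exact: lt_le_trans tc.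
have bnd s : t < s -> s < 1 -> rho s <= rho c.
  move=> ts s1; have wcs : w c <= w s by apply: cmin; rewrite in_itv/= !ltW.
  have q0 : 0 <= (p - 1)^-1 by rewrite invr_ge0 subr_ge0 ltW.
  rewrite /conj_weight !powRN lef_pV2 ?posrE ?powR_gt0 ?w_pos//; last first.
    exact: lt_trans ts.
  apply: ge0_ler_powR => //; rewrite nnegrE ltW// w_pos//.
  exact: lt_trans ts.
have it1 : mu.-integrable `]t, 1[ (EFin \o rho).
  have mut1 : (mu `]t, 1%R[ < +oo)%E.
    by rewrite lebesgue_measure_itv/=; case: ifPn => //; rewrite -EFinB ltry.
  apply: measurable_bounded_integrable => //.
  - apply/measurable_EFinP; apply: mt => s; rewrite /= in_itv/= => /andP[ts _].
    by apply/RposP; exact: lt_trans ts.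
  - exists (rho c); split; first exact: num_real.
    move=> M cM s; rewrite /= in_itv/= => /andP[ts s1].
    by rewrite ger0_norm// (le_trans (bnd s ts s1))// ltW.
move: it1 i1 => /integrableP[mt1 ft1] /integrableP[m1 f1].
have mU : measurable_fun (`]t, 1[ `|` `[1, +oo[)%classic (EFin \o rho).
  by apply/measurable_funU.
apply/integrableP; split => //; rewrite ge0_integral_setU//.
- exact: lte_add_pinfty.
- exact: measurableT_comp.
- apply/disj_setPS => s [/=]; rewrite !in_itv/= => /andP[_ s1] /andP[].
  by rewrite leNgt s1.
Qed.

Lemma Omega_inftyE t : 0 < t ->
  ((\int[mu]_(s in `]t, +oo[) (rho s)%:E) `^ (1 - p^-1))%E =
  (Omega_infty p w t)%:E.
Proof.
move=> t0; rewrite /Omega_infty /Rintegral -poweR_EFin fineK//.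
by apply: integrable_fin_num => //; exact: integrable_conj_weight.
Qed.

Lemma Omega_infty_gt0 t : 0 < t -> 0 < Omega_infty p w t.
Proof.
move=> t0; apply: powR_gt0; rewrite lt_neqAle; apply/andP; split; last first.
  by apply: Rintegral_ge0 => s _; exact: powR_ge0.
apply/eqP => int0.
have it := integrable_conj_weight t0.
have : (\int[mu]_(s in `]t, +oo[) `|(EFin \o rho) s| = 0)%E.
  under eq_integral do rewrite /= ger0_norm ?powR_ge0//.
  rewrite -[LHS]fineK; first by rewrite [fine _](esym int0).
  exact: integrable_fin_num.
move/ae_eq_integral_abs => /(_ (measurable_itv _) (measurable_int mu it)).
move=> [N [mN N0 tN]].
have : (mu `]t, +oo[ <= mu N)%E.
  rewrite le_measure ?inE// => s ts; apply: tN => /= /(_ ts)[].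
  by apply/eqP; rewrite gt_eqF// conj_weight_gt0//; apply/RposP/(tail_Rpos t0).
by rewrite N0 lebesgue_measure_itv/= ltry.
Qed.

Lemma Omega_infty_nonincreasing s t : 0 < s -> s <= t ->
  Omega_infty p w t <= Omega_infty p w s.
Proof.
move=> s0 st; apply: ge0_ler_powR.
- by rewrite subr_ge0 invf_le1// ltW.
- by rewrite nnegrE; apply: Rintegral_ge0 => x _; exact: powR_ge0.
- by rewrite nnegrE; apply: Rintegral_ge0 => x _; exact: powR_ge0.
rewrite -subr_ge0 tail_integralB//; last exact: integrable_conj_weight.
by apply: Rintegral_ge0 => x _; exact: powR_ge0.
Qed.

Definition tail_norm (v : R -> R) t :=
  (\int[mu]_(s in `]t, +oo[) (`|v s| `^ p * w s)) `^ p^-1.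

Section tail_of_Lp.
Variables (v : R -> R).
Hypotheses (mv : measurable_fun (@Rpos R) v)
  (vp : (weighted_Lpnorm p w v < +oo)%E).

Lemma integrable_weighted_power :
  mu.-integrable (@Rpos R) (EFin \o (fun s => `|v s| `^ p * w s)).
Proof.
apply/integrableP; split.
  apply/measurable_EFinP; apply: measurable_funM; last exact: measurable_weight.
  by apply: (measurableT_comp (measurable_powR _)); exact: measurableT_comp.
under eq_integral => s.
  rewrite inE => /RposP s0; rewrite /= ger0_norm; last first.
    by rewrite mulr_ge0// ?powR_ge0// ltW// w_pos.
  over.
move: vp; rewrite /weighted_Lpnorm; set I := (\int[_]_(_ in _) _)%E.
rewrite !ltey; apply: contra_neqN => /eqP ->; rewrite poweRyr//.
by rewrite invr_eq0 gt_eqF.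
Qed.

Lemma tail_norm_le t : 0 < t -> tail_norm v t <= fine (weighted_Lpnorm p w v).
Proof.
move=> t0; rewrite /weighted_Lpnorm.
have ii := integrable_weighted_power.
have finI : (\int[mu]_(s in Rpos) (`|v s| `^ p * w s)%:E)%E \is a fin_num.
  by apply: integrable_fin_num => //; exact: measurable_Rpos.
rewrite -[X in poweR X]fineK; last exact: finI.
rewrite poweR_EFin/=; apply: ge0_ler_powR.
- by rewrite invr_ge0 ltW.
- rewrite nnegrE; apply: Rintegral_ge0 => s /(tail_Rpos t0)/RposP s0.
  by rewrite mulr_ge0// ?powR_ge0// ltW// w_pos.
- rewrite nnegrE fine_ge0//; apply: integral_ge0 => s /RposP s0.
  by rewrite lee_fin mulr_ge0// ?powR_ge0// ltW// w_pos.
rewrite fine_le//.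
- apply: integrable_fin_num => //; apply: integrableS ii => //.
    exact: measurable_Rpos.
  exact: tail_Rpos.
- apply: ge0_subset_integral => //.
  + exact: measurable_Rpos.
  + exact: (measurable_int mu ii).
  + move=> s /RposP s0.
    by rewrite lee_fin mulr_ge0// ?powR_ge0// ltW// w_pos.
  + exact: tail_Rpos.
Qed.

Lemma tail_norm_cvg0 : tail_norm v t @[t --> +oo] --> 0.
Proof.
have ii := integrable_tail_cvg0 integrable_weighted_power.
apply/cvgr0Pnorm_lt => e e0; near=> t.
have t0 : 0 < t by near: t; apply: nbhs_pinfty_gt; exact: num_real.
have I0 : 0 <= \int[mu]_(s in `]t, +oo[) (`|v s| `^ p * w s).
  apply: Rintegral_ge0 => s /(tail_Rpos t0)/RposP s0.
  by rewrite mulr_ge0// ?powR_ge0// ltW// w_pos.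
rewrite ger0_norm ?powR_ge0// /tail_norm.
rewrite -[ltRHS](powRr1 (ltW e0)) -(mulfV (lt0r_neq0 p0)) powRrM.
apply: gt0_ltr_powR; rewrite ?invr_gt0// ?nnegrE ?powR_ge0//.
rewrite -(ger0_norm I0); near: t.
by move/cvgr0Pnorm_lt: ii; apply; rewrite powR_gt0.
Unshelve. all: by end_near. Qed.

Lemma hoelder_tail t : 0 < t ->
  (\int[mu]_(s in `]t, +oo[) `|v s|%:E <=
   (tail_norm v t * Omega_infty p w t)%:E)%E.
Proof.
move=> t0; rewrite EFinM.
apply: le_trans (hoelder_weighted p_gt1 w_pos w_cont _ (tail_Rpos t0) mv) _ => //.
rewrite le_eqVlt; apply/orP; left; apply/eqP.
congr (_ * _)%E; last exact: Omega_inftyE.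
rewrite /tail_norm /Rintegral -poweR_EFin fineK//.
apply: integrable_fin_num => //.
apply: integrableS integrable_weighted_power => //.
  exact: measurable_Rpos.
exact: tail_Rpos.
Qed.

Lemma integrable_Lp_tail t : 0 < t -> mu.-integrable `]t, +oo[ (EFin \o v).
Proof.
move=> t0; apply/integrableP; split; last first.
  by apply: le_lt_trans (hoelder_tail t0) (ltry _).
apply/measurable_EFinP; apply: measurable_funS mv => //.
  exact: measurable_Rpos.
exact: tail_Rpos.
Qed.

(** The pointwise estimate behind the whole theorem. *)
Lemma tail_integral_le t : 0 < t ->
  `|\int[mu]_(s in `]t, +oo[) v s| <= tail_norm v t * Omega_infty p w t.
Proof.
move=> t0; have iv := integrable_Lp_tail t0.
apply: le_trans (le_normr_Rintegral _ iv) _ => //.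
rewrite -lee_fin /Rintegral fineK; first exact: hoelder_tail.
by apply: integrable_fin_num => //; exact: integrable_norm iv.
Qed.

End tail_of_Lp.
End tails.

(** * The trace at infinity *)

Section traces.
Context {R : realType}.
Notation mu := (@lebesgue_measure R).
Implicit Types (u v g : R -> R).

Variables (p : R) (w : R -> R).
Hypotheses (p_gt1 : 1 < p) (w_pos : forall t : R, 0 < t -> 0 < w t)
  (w_cont : {within Rpos, continuous w}) (w_Bp : Bp_infty p w).

Local Notation wnorm := (weighted_Lpnorm p w).
Local Notation Omega := (Omega_infty p w).

Lemma weighted_LpnormN v : wnorm (fun t => - v t) = wnorm v.
Proof. by rewrite /weighted_Lpnorm; under eq_integral do rewrite normrN. Qed.

Lemma weighted_LpN v : weighted_Lp p w v -> weighted_Lp p w (fun t => - v t).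
Proof.
by move=> [mv vp]; split; [exact: measurableT_comp|rewrite weighted_LpnormN].
Qed.

Lemma tail_integral_primitive u v c : weighted_Lp p w v -> tail_integral v c u ->
  is_primitive u (fun t => - v t).
Proof.
move=> [mv vp] uv; split=> [|x y x0 xy]; first exact: measurableT_comp.
have y0 := lt_le_trans x0 xy.
have ivx := integrable_Lp_tail p_gt1 w_pos w_cont w_Bp mv vp x0.
have iv : mu.-integrable `]x, y] (EFin \o v).
  by apply: integrableS ivx => //; exact: subset_itvl.
have vN : (fun t => - v t) = (fun t => -1 * v t).
  by apply/funext => t; rewrite mulN1r.
split.
  have -> : EFin \o (fun t => - v t) = (fun t => (-1)%:E * (EFin \o v) t)%E.
    by apply/funext => t; rewrite vN /= EFinM.
  exact: integrableZl.
rewrite vN RintegralZl// mulN1r -tail_integralB// !uv//; ring.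
Qed.

(** The constant is read off at the point 1; since the increments of u are the
    integrals of g, the formula at 1 gives it everywhere. *)
Lemma primitive_tail_integral u g : is_primitive u g -> (wnorm g < +oo)%E ->
  exists c, tail_integral (fun t => - g t) c u.
Proof.
move=> [mg ug] gp; exists (u 1 + \int[mu]_(s in `]1, +oo[) g s) => t t0.
have ig s := integrable_Lp_tail p_gt1 w_pos w_cont w_Bp mg gp (t := s).
have gN : (fun t => - g t) = (fun t => -1 * g t).
  by apply/funext => s; rewrite mulN1r.
rewrite gN RintegralZl//; last exact: ig.
have [t1|/ltW t1] := leP t 1.
  have [_] := ug t 1 t0 t1; rewrite -tail_integralB//; last exact: ig.
  by move/eqP; rewrite subr_eq => /eqP ->; ring.
have [_] := ug 1 t ltr01 t1; rewrite -tail_integralB//; last exact: ig.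
by move/eqP; rewrite subr_eq => /eqP ->; ring.
Qed.

Lemma dirichlet_calR u : dirichlet p w u -> exists c, calR_infty p w c u.
Proof.
move=> /[dup] Du /(dirichletP p w_pos)[_ [g ug gp]].
have [c uc] := primitive_tail_integral ug gp; exists c; split; first exact: Du.
exists (fun t => - g t); last exact: uc.
by apply: weighted_LpN; split; [case: ug|exact: gp].
Qed.

Lemma tail_integral_dirichlet u v c : fun_on_Rpos u -> weighted_Lp p w v ->
  tail_integral v c u -> dirichlet p w u.
Proof.
move=> u0 Lv uv; apply/(dirichletP p w_pos); split; first exact: u0.
exists (fun t => - v t); first exact: tail_integral_primitive uv.
by case: (weighted_LpN Lv).
Qed.

Lemma calR_cvg c u : calR_infty p w c u -> u t @[t --> +oo] --> c.
Proof.
move=> [_ [v [mv vp] uv]].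
have tail0 := integrable_tail_cvg0
  (integrable_Lp_tail p_gt1 w_pos w_cont w_Bp mv vp ltr01).
have tailc : (\int[mu]_(s in `]t, +oo[) v s) + c @[t --> +oo] --> c.
  by rewrite -[X in _ --> X]add0r; apply: cvgD tail0 _; exact: cvg_cst.
apply: cvg_trans tailc; apply: near_eq_cvg; near=> t; apply/esym/uv.
by near: t; apply: nbhs_pinfty_gt; exact: num_real.
Unshelve. all: by end_near. Qed.

Lemma calR_Tr c u : calR_infty p w c u -> Tr_infty u = c.
Proof. by move=> /calR_cvg uc; exact/cvg_lim. Qed.

Lemma dirichlet_TrP u : dirichlet p w u -> calR_infty p w (Tr_infty u) u.
Proof. by move=> /dirichlet_calR[c uc]; rewrite (calR_Tr uc). Qed.

Lemma dirichlet_cvg u : dirichlet p w u -> u t @[t --> +oo] --> Tr_infty u.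
Proof. by move=> /dirichlet_TrP/calR_cvg. Qed.

Lemma calR_calC c u : calR_infty p w c u -> calC_infty p w c u.
Proof.
move=> [Du [v [mv vp] uv]].
have bnd t : 0 < t -> `|(u t - c) / Omega t| <= tail_norm p w v t.
  move=> t0; have O0 := Omega_infty_gt0 p_gt1 w_pos w_cont w_Bp t0.
  rewrite normrM normfV (gtr0_norm O0) ler_pdivrMr// uv// addrK.
  exact: tail_integral_le.
split; first exact: Du.
- apply/cvgr0Pnorm_le => e e0.
  have := tail_norm_cvg0 p_gt1 w_pos w_cont mv vp.
  move/cvgr0Pnorm_le => /(_ e e0) small; near=> t.
  have t0 : 0 < t by near: t; apply: nbhs_pinfty_gt; exact: num_real.
  apply: (le_trans (bnd t t0)); apply: le_trans (ler_norm _) _.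
  by near: t.
- apply: le_lt_trans (ltry (fine (wnorm v))).
  apply: ge_ereal_sup => _ [t /RposP t0 <-].
  rewrite lee_fin; apply: le_trans (ler_norm _) (le_trans (bnd t t0) _).
  exact: tail_norm_le.
Unshelve. all: by end_near. Qed.

Lemma calC_calB c u : calC_infty p w c u -> calB_infty p w c u.
Proof.
move=> [Du uc _]; split; first exact: Du.
apply/cvgrPdist_lt => e e0.
(* Omega is at most Omega 1 on [1, oo[, so e / Omega 1 suffices. *)
have ratio (x A B : R) : 0 < A -> A <= B -> `|x / A| < e / B -> `|x| < e.
  move=> A0 AB; rewrite normrM normfV (gtr0_norm A0) ltr_pdivrMr//.
  move=> /lt_le_trans; apply.
  by rewrite mulrAC ler_pdivrMr ?(lt_le_trans A0)// ler_pM2l.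
have O1 := Omega_infty_gt0 p_gt1 w_pos w_cont w_Bp ltr01.
move/cvgr0Pnorm_lt: uc => /(_ (e / Omega 1) (divr_gt0 e0 O1)) uc.
near=> t; have t1 : 1 <= t by near: t; apply: nbhs_pinfty_ge; exact: num_real.
have t0 : 0 < t by exact: lt_le_trans t1.
rewrite distrC; apply: (ratio _ (Omega t) (Omega 1)).
- exact: Omega_infty_gt0.
- exact: Omega_infty_nonincreasing.
- by near: t.
Unshelve. all: by end_near. Qed.

Lemma calB_calA c u : calB_infty p w c u -> calA_infty p w c u.
Proof.
have n_y : n.+1%:R @[n --> \oo] --> (+oo : set_system R).
  apply/cvgryPge => A; near=> n; rewrite (le_trans _ (_ : n%:R <= _)) ?ler_nat//.
  by near: n; exact: nbhs_infty_ger.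
move=> [Du uc]; split; first exact: Du.
exists (fun n => n.+1%:R); split; first by [].
- by apply/nondecreasing_seqP => n; rewrite ler_nat.
- exact: n_y.
- exact: cvg_comp uc.
Unshelve. all: by end_near. Qed.

(** u converges to its trace, and along t_n also to c. *)
Lemma calA_calR c u : calA_infty p w c u -> calR_infty p w c u.
Proof.
move=> [Du [t_ [_ _ t_y utc]]]; have uR := dirichlet_TrP Du.
suff <- : Tr_infty u = c by [].
have utTr : u (t_ n) @[n --> \oo] --> Tr_infty u.
  exact: (cvg_comp t_ u t_y (calR_cvg uR)).
by rewrite -(cvg_lim _ utTr)//; exact/cvg_lim.
Qed.

Lemma dirichlet_trace_le u a : dirichlet p w u -> 0 < a ->
  `|u a - Tr_infty u| <= fine (wnorm (derive1 u)) * Omega a.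
Proof.
move=> Du a0; have [_ [v [mv vp] uv]] := dirichlet_TrP Du.
have uv' := tail_integral_primitive (conj mv vp) uv.
rewrite (dirichlet_primitive_norm p w_pos uv') weighted_LpnormN uv// addrK.
apply: le_trans (tail_integral_le p_gt1 w_pos w_cont w_Bp mv vp a0) _.
by rewrite ler_wpM2r// ?tail_norm_le// ltW// Omega_infty_gt0.
Qed.

Lemma dirichlet_linear : linear_subspace (dirichlet p w).
Proof.
split; first apply/(dirichletP p w_pos).
  split => //; exists (fun=> 0); first exact: is_primitive0.
  (* The norm of 0 is computed by homogeneity. *)
  have -> : (fun=> 0) = (fun t => 0 * (cst 0 t)) :> (R -> R).
    by apply/funext => t; rewrite mul0r.
  by rewrite weighted_LpnormZ// normr0 mul0e.
move=> k u v /(dirichletP p w_pos)[u0 [g ug gp]].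
move=> /(dirichletP p w_pos)[v0 [h vh hp]].
apply/(dirichletP p w_pos); split.
  by move=> t t0; rewrite !fctE u0// v0// scaler0 addr0.
have [mg _] := ug; have [mh _] := vh.
exists (fun t => k * g t + h t).
  by apply: is_primitiveD => //; exact: is_primitiveZ.
have mkg : measurable_fun (@Rpos R) (fun t => k * g t).
  exact: measurable_funM.
apply: le_lt_trans (weighted_LpnormD p_gt1 w_pos w_cont mkg mh) _.
apply: lte_add_pinfty; last exact: hp.
rewrite (weighted_LpnormZ p_gt1 w_pos w_cont k mg).
by apply: lte_mul_pinfty; [rewrite lee_fin|by []|exact: gp].
Qed.

Definition derivative_norm u := fine (wnorm (derive1 u)).

Lemma derivative_norm_ge0 u : 0 <= derivative_norm u.
Proof. by rewrite fine_ge0// weighted_Lpnorm_ge0. Qed.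

Lemma derivative_normZ k u : dirichlet p w u ->
  derivative_norm (k *: u) = `|k| * derivative_norm u.
Proof.
move=> /(dirichletP p w_pos)[_ [g ug gp]]; have [mg _] := ug.
have kug := is_primitiveZ k ug.
rewrite /derivative_norm (dirichlet_primitive_norm p w_pos kug).
rewrite (dirichlet_primitive_norm p w_pos ug) weighted_LpnormZ// fineM//.
by rewrite ge0_fin_numE// weighted_Lpnorm_ge0.
Qed.

Lemma derivative_normD u v : dirichlet p w u -> dirichlet p w v ->
  derivative_norm (u + v) <= derivative_norm u + derivative_norm v.
Proof.
move=> /(dirichletP p w_pos)[_ [g ug gp]]; have [mg _] := ug.
move=> /(dirichletP p w_pos)[_ [h vh hp]]; have [mh _] := vh.
have uvgh := is_primitiveD ug vh.
rewrite /derivative_norm (dirichlet_primitive_norm p w_pos uvgh).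
rewrite (dirichlet_primitive_norm p w_pos ug).
rewrite (dirichlet_primitive_norm p w_pos vh).
have := weighted_LpnormD p_gt1 w_pos w_cont mg mh; move: gp hp.
have := weighted_Lpnorm_ge0 p w (g \+ h).
have := weighted_Lpnorm_ge0 p w g; have := weighted_Lpnorm_ge0 p w h.
move: (wnorm g) (wnorm h) (wnorm (g \+ h)) => x y z y0 x0 z0 xoo yoo zxy.
have zoo : (z < +oo)%E by apply: le_lt_trans zxy _; exact: lte_add_pinfty.
by rewrite -fineD ?fine_le ?fin_numD ?ge0_fin_numE ?xoo.
Qed.

Lemma dirichlet_norm_inftyE u :
  dirichlet_norm_infty p w u = derivative_norm u + `|Tr_infty u|.
Proof. by []. Qed.

Lemma TrZ k u : dirichlet p w u -> Tr_infty (k *: u) = k * Tr_infty u.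
Proof.
move=> /dirichlet_cvg uT; apply/cvg_lim => //.
by apply: cvgM => //; exact: cvg_cst.
Qed.

Lemma TrD u v : dirichlet p w u -> dirichlet p w v ->
  Tr_infty (u + v) = Tr_infty u + Tr_infty v.
Proof.
by move=> /dirichlet_cvg uT /dirichlet_cvg vT; apply/cvg_lim => //; exact: cvgD.
Qed.

Lemma dirichlet_norm_infty_norm :
  norm_on (dirichlet p w) (dirichlet_norm_infty p w).
Proof.
have S0 := derivative_norm_ge0.
split.
- exact: dirichlet_linear.
- by move=> u Du; rewrite addr_ge0// S0.
- move=> u Du; rewrite dirichlet_norm_inftyE => /eqP.
  rewrite paddr_eq0 ?S0// normr_eq0 => /andP[/eqP Su /eqP Tu].
  apply/funext => t; have [t0|t0] := leP t 0.
    by case: Du => u0 _ _; exact: u0.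
  have := dirichlet_trace_le Du t0.
  by rewrite -/(derivative_norm u) Su mul0r Tu subr0 normr_le0 => /eqP.
- move=> k u Du; rewrite !dirichlet_norm_inftyE.
  by rewrite derivative_normZ// TrZ// normrM mulrDr.
- move=> u v Du Dv; rewrite !dirichlet_norm_inftyE.
  rewrite TrD// addrACA lerD//; first exact: derivative_normD.
  exact: ler_normD.
Qed.

(** |u a| and |Tr u| differ by at most Omega a times the norm of u'. *)
Lemma dirichlet_norm_le u a : dirichlet p w u -> 0 < a ->
  dirichlet_norm p w a u <= (1 + Omega a) * dirichlet_norm_infty p w u /\
  dirichlet_norm_infty p w u <= (1 + Omega a) * dirichlet_norm p w a u.
Proof.
move=> Du a0; have := dirichlet_trace_le Du a0.
rewrite dirichlet_norm_inftyE /dirichlet_norm -/(derivative_norm u).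
have Oa := Omega_infty_gt0 p_gt1 w_pos w_cont w_Bp a0.
have := derivative_norm_ge0 u; move: (derivative_norm u) => S S0 uaT.
have u1 : `|u a| <= S * Omega a + `|Tr_infty u|.
  by rewrite -lerBlDr; apply: le_trans (lerB_dist _ _) uaT.
have u2 : `|Tr_infty u| <= S * Omega a + `|u a|.
  by rewrite -lerBlDr; apply: le_trans (lerB_dist _ _) _; rewrite distrC.
have := mulr_ge0 (ltW Oa) (normr_ge0 (Tr_infty u)).
have := mulr_ge0 (ltW Oa) (normr_ge0 (u a)).
by move=> h1 h2; split; lra.
Qed.

Lemma equivalent_dirichlet_norms a : 0 < a ->
  equivalent_norms_on (dirichlet p w)
    (dirichlet_norm_infty p w) (dirichlet_norm p w a).
Proof.
move=> a0; have Oa := Omega_infty_gt0 p_gt1 w_pos w_cont w_Bp a0.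
have O1 : 0 < 1 + Omega a by rewrite addr_gt0.
exists (1 + Omega a)^-1, (1 + Omega a); split => //; first by rewrite invr_gt0.
move=> u Du; have [h1 h2] := dirichlet_norm_le Du a0; split => //.
by rewrite mulrC ler_pdivrMr// mulrC.
Qed.

(** The set of index c is the level set Tr u = c, and Tr is Lipschitz for the
    norm at a. *)
Lemma calR_closed c a : 0 < a ->
  norm_closed_in (dirichlet p w) (dirichlet_norm p w a) (calR_infty p w c).
Proof.
move=> a0; split=> [u [//]|u Du nRu].
have Oa := Omega_infty_gt0 p_gt1 w_pos w_cont w_Bp a0.
have O1 : 0 < 1 + Omega a by rewrite addr_gt0.
have Tc : 0 < `|c - Tr_infty u|.
  rewrite normr_gt0 subr_eq0; apply: contra_notN nRu => /eqP ->.
  exact: dirichlet_TrP.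
exists (`|c - Tr_infty u| / (1 + Omega a)); first by rewrite divr_gt0.
move=> v Dv; rewrite ltr_pdivlMr// mulrC => vu /calR_Tr Tv.
have [_ Dlin] := dirichlet_linear.
have DNu : dirichlet p w (-1 *: u).
  by have := Dlin (-1) u 0 Du dirichlet_linear.1; rewrite addr0.
have Dvu : dirichlet p w (v - u).
  by have := Dlin (-1) u v Du Dv; rewrite scaleN1r addrC.
have [_ h] := dirichlet_norm_le Dvu a0.
suff : `|c - Tr_infty u| <= dirichlet_norm_infty p w (v - u).
  by move=> h'; have := lt_le_trans (le_lt_trans h vu) h'; rewrite ltxx.
rewrite dirichlet_norm_inftyE -Tv.
have -> : Tr_infty (v - u) = Tr_infty v - Tr_infty u.
  by rewrite -(scaleN1r u) (TrD Dv DNu) (TrZ _ Du) mulN1r.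
by rewrite lerDr derivative_norm_ge0.
Qed.

End traces.

Theorem theorem3p2 (R : realType) (p : R) (w : R -> R)
  (p_gt1 : 1 < p)
  (w_pos : forall t : R, 0 < t -> 0 < w t)
  (w_cont : {within Rpos, continuous w})
  (w_Bp : Bp_infty p w) :
  (* (i) *)
  (forall c a : R, 0 < a ->
     norm_closed_in (dirichlet p w) (dirichlet_norm p w a) (calR_infty p w c))
  /\
  (* (ii) *)
  (forall c : R,
     [/\ calA_infty p w c = calB_infty p w c,
         calB_infty p w c = calC_infty p w c &
         calC_infty p w c = calR_infty p w c])
  /\
  (* (iii) *)
  [/\ (forall u : R -> R, dirichlet p w u -> exists c : R, calR_infty p w c u),
      (forall u : R -> R, dirichlet p w u -> cvg (u t @[t --> +oo])),
      dirichlet p w = \bigcup_(c in [set: R]) calR_infty p w c &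
      dirichlet p w =
        [set u : R -> R | fun_on_Rpos u /\
           exists c : R, exists2 v : R -> R,
             weighted_Lp p w v & tail_integral v c u]]
  /\
  (* (iv) *)
  (norm_on (dirichlet p w) (dirichlet_norm_infty p w) /\
   forall a : R, 0 < a ->
     equivalent_norms_on (dirichlet p w)
       (dirichlet_norm_infty p w) (dirichlet_norm p w a)).
Proof.
have RC c : calR_infty p w c `<=` calC_infty p w c by move=> u; exact: calR_calC.
have CB c : calC_infty p w c `<=` calB_infty p w c by move=> u; exact: calC_calB.
have BA c : calB_infty p w c `<=` calA_infty p w c by move=> u; exact: calB_calA.
have AR c : calA_infty p w c `<=` calR_infty p w c by move=> u; exact: calA_calR.
split; first by move=> c a; exact: calR_closed.
split.
  move=> c; split; apply/seteqP; split => //.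
  - by apply: subset_trans (@AR c) _; apply: subset_trans (@RC c) _.
  - by apply: subset_trans (@BA c) _; apply: subset_trans (@AR c) _.
  - by apply: subset_trans (@CB c) _; apply: subset_trans (@BA c) _.
split; last first.
  split=> [|a]; first exact: dirichlet_norm_infty_norm.
  exact: equivalent_dirichlet_norms.
split.
- by move=> u; exact: dirichlet_calR.
- by move=> u Du; apply: cvgP (dirichlet_cvg p_gt1 w_pos w_cont w_Bp Du).
- apply/seteqP; split => u; last by case=> c _ [].
  by move=> /(dirichlet_calR p_gt1 w_pos w_cont w_Bp)[c uc]; exists c.
- apply/seteqP; split => u.
    move=> /[dup] -[u0 _ _].
    move=> /(dirichlet_calR p_gt1 w_pos w_cont w_Bp)[c [_ [v Lv uv]]].
    by split => //; exists c, v.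
  by move=> [u0 [c [v Lv uv]]]; exact: tail_integral_dirichlet uv.
Qed.
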